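(* Let $R$ be either $\mathbb{Q}$ or $\mathbb{Z}_p$ with $p$ a prime, $p>d$. Let $r\ge 1$, let $a\in\mathbb{Q}$, and let $B_0,\bar B_0,B_1,\bar B_1,\dots,B_r,\bar B_r$ be finite multisets of nonzero integers. Define $gtd_n\in R[y_1,\dots,y_r]$ by $$F(s)=\sum_{n\ge 0} gtd_n\, s^n=e^{as}\,\frac{\prod_{b\in B_0} f(bs)}{\prod_{b\in\bar B_0} f(bs)}\prod_{i=1}^r\frac{\prod_{b\in B_i} f(bs,y_i)}{\prod_{b\in\bar B_i} f(bs,y_i)},\qquad f(s)=\frac{s}{e^s-1},\quad f(s,y)=\frac{1}{1-y(e^s-1)}.$$ Then the sequence $(gtd_0,gtd_1,\dots,gtd_{d-1})$ can be computed using $$O\Big((r+1)d^{r+1}\log(d)+\log^2(d)\sum_{i=0}^r\big(|B_i|+|\bar B_i|\big)\Big)$$ operations in $R$.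
   Context: The $gtd_n$ are called generalized Todd polynomials. The series $f(s)$ and $f(s,y)$ are expanded as formal power series in $s$ (both have constant term $1$). Multisets are counted with multiplicity; $|B|$ denotes the cardinality with multiplicity. When $R=\mathbb{Z}_p$, the numbers $a$ and $b$ are reduced modulo $p$ (the denominator of $a$ being prime to $p$), and everything is computed modulo $s^d$; since $p>d$ the coefficients of $s^0,\dots,s^{d-1}$ make sense over $\mathbb{Z}_p$. Cost is the number of ring operations in $R$. It is assumed that the fast Fourier transform can be performed, so that two polynomials over $R$ of degree less than $n$ can be multiplied using $O(n\log n)$ operations in $R$. *)

(* Defs.v *)
From HB Require Import structures.
From mathcomp Require Import all_boot all_order all_algebra.
From mathcomp Require Import mpoly.

Set Implicit Arguments.
Unset Strict Implicit.
Unset Printing Implicit Defensive.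

Import GRing.Theory.
Local Open Scope ring_scope.

(* A formal power series \sum_n u_n s^n over A is the function n |-> u_n.     *)
Section PowerSeries.
Variable A : comNzRingType.
Implicit Types u v : nat -> A.

Definition ps_one : nat -> A := fun n => (n == 0%N)%:R.

Definition ps_sub u v : nat -> A := fun n => u n - v n.

Definition ps_mul u v : nat -> A :=
  fun n => \sum_(i < n.+1) u i * v (n - i)%N.

Definition ps_pow u (k : nat) : nat -> A := iter k (ps_mul u) ps_one.

(* For u with constant term 1, 1 / u = \sum_k (1 - u)^k, where only the terms *)
(* k <= n contribute to the coefficient of s^n (see ps_mulV).                 *)
Definition ps_inv u : nat -> A :=
  fun n => \sum_(k < n.+1) ps_pow (ps_sub ps_one u) k n.

Definition ps_div u v : nat -> A := ps_mul u (ps_inv v).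

(* The substitution s |-> c s. *)
Definition ps_dilate (c : A) u : nat -> A := fun n => c ^+ n * u n.

Lemma ps_powE u k (n N : nat) : (n < N)%N ->
  ps_pow u k n = ((\poly_(i < N) u i) ^+ k)`_n.
Proof.
elim: k n => [|k IHk] n ltnN; first by rewrite expr0 coef1.
rewrite exprS coefM; apply: eq_bigr => i _.
rewrite -IHk ?(leq_ltn_trans (leq_subr _ _)) // coef_poly.
by rewrite (leq_ltn_trans _ ltnN) // -ltnS.
Qed.

Lemma ps_mulV u : u 0%N = 1 -> ps_mul u (ps_inv u) =1 ps_one.
Proof.
move=> u0 n; pose N := n.+1.
pose w := \poly_(i < N) ps_sub ps_one u i.
have w0 : w`_0 = 0 by rewrite coef_poly /ps_sub /ps_one /= u0 subrr.
have wX : w = (\poly_(i < N) w`_i.+1) * 'X.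
  apply/polyP => -[|i]; first by rewrite w0 coefMX.
  rewrite coefMX /= [in RHS]coef_poly; case: ltnP => // leNi.
  by rewrite coef_poly ltnNge (leq_trans leNi).
have wk (k m : nat) : (m < k)%N -> (w ^+ k)`_m = 0.
  by move=> ltmk; rewrite wX exprMn_comm ?coefMXn ?ltmk //; apply: commr_polyX.
have invE (m : nat) : (m < N)%N -> ps_inv u m = (\sum_(k < N) w ^+ k)`_m.
  move=> ltmN; rewrite coef_sum /ps_inv.
  rewrite (big_ord_widen N (fun k => ps_pow (ps_sub ps_one u) k m) ltmN).
  rewrite [RHS](bigID (fun k : 'I_N => (k < m.+1)%N)) /= [X in _ + X]big1.
    by rewrite addr0; apply: eq_bigr => k _; apply: ps_powE.
  by move=> k; rewrite -leqNgt => /wk.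
have uE (i : nat) : (i < N)%N -> u i = (1 - w)`_i.
  by move=> ltiN; rewrite coefB coef1 coef_poly ltiN /ps_sub subKr.
transitivity (((1 - w) * \sum_(k < N) w ^+ k)`_n).
  rewrite coefM; apply: eq_bigr => i _.
  by rewrite uE ?invE // /N ltnS leq_subr.
have -> : (1 - w) * (\sum_(k < N) w ^+ k) = 1 - w ^+ N.
  by rewrite -(opprB w) mulNr -subrX1 opprB.
by rewrite coefB coef1 wk ?subr0.
Qed.

End PowerSeries.

Section GeneralizedTodd.
Variables (R : fieldType) (r : nat).
Local Notation A := {mpoly R[r]}.

(* In characteristic p only the coefficients of s^n with n < p (n < p - 1 for *)
(* ps_todd) have their intended value: beyond them n`!%:R^-1 is 0^-1 = 0.     *)
Definition ps_exp : nat -> A := fun n => (n`!%:R^-1)%:MP.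

(* s / (e^s - 1), the inverse of (e^s - 1) / s = \sum_n s^n / (n + 1)! *)
Definition ps_todd : nat -> A := ps_inv (fun n => ps_exp n.+1).

(* 1 / (1 - y (e^s - 1)) *)
Definition ps_todd_y (y : A) : nat -> A :=
  ps_inv (ps_sub (ps_one A) (fun n => y * ps_sub ps_exp (ps_one A) n)).

Definition ps_prod_dilate (u : nat -> A) (B : seq int) : nat -> A :=
  \big[@ps_mul A/ps_one A]_(b <- B) ps_dilate b%:~R u.

(* The multisets are listed as sequences, B_i (resp. \bar B_i) being B i      *)
(* (resp. B' i); the variable y_i with 1 <= i <= r is 'X_(i - 1), and its     *)
(* multisets are those of index lift ord0 (i - 1).                            *)
Definition gtd (a : rat) (B B' : 'I_r.+1 -> seq int) : nat -> A :=
  ps_mul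
    (ps_mul (ps_dilate (ratr a : R)%:MP ps_exp)
            (ps_div (ps_prod_dilate ps_todd (B ord0))
                    (ps_prod_dilate ps_todd (B' ord0))))
    (\big[@ps_mul A/ps_one A]_(i < r)
       ps_div (ps_prod_dilate (ps_todd_y 'X_i) (B (lift ord0 i)))
              (ps_prod_dilate (ps_todd_y 'X_i) (B' (lift ord0 i)))).

End GeneralizedTodd.

(* Straight-line programs over R, with unit cost for each operation. The      *)
(* registers first hold the inputs; each instruction appends its result as a  *)
(* new register. Besides 0 and 1, the constants satisfying K (such as the     *)
(* roots of unity used by the fast Fourier transform) are available for free. *)
(* As x / y is only defined for y invertible, programs cannot use division to *)
(* test for 0.                                                                *)
Inductive operand (R : Type) := Reg of nat | Cst of R.

Inductive instr (R : Type) :=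
  | Add of operand R & operand R
  | Sub of operand R & operand R
  | Mul of operand R & operand R
  | Div of operand R & operand R.

Definition slp (R : Type) := seq (instr R).

Definition cost (R : Type) (P : slp R) : nat := size P.

Section Semantics.
Variables (R : fieldType) (K : pred R).

Definition read (mem : seq R) (x : operand R) : option R :=
  match x with
  | Reg i => onth mem i
  | Cst c => if [|| c == 0, c == 1 | K c] then Some c else None
  end.

Definition read2 (mem : seq R) (x y : operand R) (f : R -> R -> option R) :
    option R :=
  obind (fun u => obind (f u) (read mem y)) (read mem x).

Definition eval (mem : seq R) (c : instr R) : option R :=
  match c with
  | Add x y => read2 mem x y (fun u v => Some (u + v))
  | Sub x y => read2 mem x y (fun u v => Some (u - v))
  | Mul x y => read2 mem x y (fun u v => Some (u * v))
  | Div x y => read2 mem x y (fun u v => if v == 0 then None else Some (u / v))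
  end.

Fixpoint exec (P : slp R) (mem : seq R) : option (seq R) :=
  if P is c :: P' then
    obind (fun v => exec P' (rcons mem v)) (eval mem c)
  else Some mem.

(* The value of the operand x once P has been run on the given input. *)
Definition output (P : slp R) (input : seq R) (x : operand R) : option R :=
  obind (fun mem => read mem x) (exec P input).

End Semantics.

(* Logarithms are rounded down, in base 2. Two polynomials of degree less     *)
(* than n >= 2, given by their coefficients, can be multiplied with at most   *)
(* C0 n log n operations.                                                     *)
Definition fast_multiplication (R : fieldType) (K : pred R) (C0 : nat) : Prop :=
  forall n : nat, (1 < n)%N ->
  exists (P : slp R) (out : nat -> operand R),
    (cost P <= C0 * (n * trunc_log 2 n))%N /\
    forall p q : {poly R}, (size p <= n)%N -> (size q <= n)%N ->
    forall k : nat, (k < (n + n).-1)%N ->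
      output K P (mkseq (nth 0 p) n ++ mkseq (nth 0 q) n) (out k)
      = Some (p * q)`_k.

(* The images in R of a and of all the b's. *)
Definition gtd_input (R : fieldType) (r : nat) (a : rat)
    (B B' : 'I_r.+1 -> seq int) : seq R :=
  ratr a :: [seq b%:~R | b <- flatten [seq B i ++ B' i | i <- enum 'I_r.+1]].

(* (gtd_0, ..., gtd_(d-1)) can be computed with at most N operations when     *)
(* |B_i| = m i and |\bar B_i| = m' i: the program depends on these sizes, but *)
(* not on the numbers a and b, and the operand out n e holds the coefficient  *)
(* of the monomial e in gtd_n. The condition on denq a is void when R = rat,  *)
(* and says that the denominator of a is prime to p when R = 'F_p.            *)
Definition gtd_computable (R : fieldType) (K : pred R) (d r : nat)
    (m m' : 'I_r.+1 -> nat) (N : nat) : Prop :=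
  exists (P : slp R) (out : 'I_d -> 'X_{1..r < d} -> operand R),
    (cost P <= N)%N /\
    forall (a : rat) (B B' : 'I_r.+1 -> seq int),
      (denq a)%:~R != 0 :> R ->
      (forall i, size (B i) = m i /\ size (B' i) = m' i) ->
      (forall i b, (b \in B i) || (b \in B' i) -> b != 0) ->
      exists c : 'I_d -> 'X_{1..r < d} -> R,
        (forall n e, output K P (gtd_input R a B B') (out n e) = Some (c n e))
        /\ (forall n : 'I_d, gtd R a B B' n = \sum_e c n e *: 'X_[e]).

Definition gtd_bound (C d r : nat) (m m' : 'I_r.+1 -> nat) : nat :=
  (C * (r.+1 * d ^ r.+1 * trunc_log 2 d
        + trunc_log 2 d ^ 2 * \sum_(i < r.+1) (m i + m' i)))%N.

(* Main.v *)
(* Let theta = s d/ds. A product of dilated series u(bs) is determined by its  *)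
(* logarithmic derivative, \sum_b w(bs) with w = theta u / u, whose n-th       *)
(* coefficient is w_n times the n-th power sum of the b's; the power sums are  *)
(* in turn read off the logarithmic derivative of \prod_b (1 - b s), which a   *)
(* product tree computes modulo s^d in O(|B| log^2 d) operations. Each of the  *)
(* r + 1 factors of F, a series in s and y_i, is thus the solution of an       *)
(* equation theta G = W G, solved modulo (s^d, y_i^d) by Newton iteration on   *)
(* G and 1 / G with Kronecker products, in O(d^2 log d) operations. As the     *)
(* coefficient of y^e in F is the product of r + 1 series in s, one for each   *)
(* factor, the at most d^r exponents e cost O(r d log d) operations each.      *)
Require Import Defs.
From HB Require Import structures.
From mathcomp Require Import all_boot all_order all_algebra.
From mathcomp Require Import mpoly zify ring.

Set Implicit Arguments.
Unset Strict Implicit.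
Unset Printing Implicit Defensive.
Import GRing.Theory.

(** * Values computed by straight-line programs *)

(** The series F is a product of r + 1 factors, each a series in s and at most one variable, so each
    is computed in R[y][s] modulo (s^d, y^d) and the factors are combined only at the end.

    Put theta = s d/ds ([euler]). A factor G has constant term 1 and solves theta G = W G, where the
    logarithmic derivative W is additive over products. If w belongs to f(s), then w(bs) belongs to
    f(bs); hence the n-th coefficient of W is w_n times a difference of n-th power sums, plus that
    of a s in the factor of index 0. The multisets therefore enter only through their power sums,
    which are the coefficients of -(theta D) / D for D = \prod_b (1 - b s) ([linear_logder_coef]). A
    product tree over blocks of d elements gives D ([compute_prod_linear]), at O(log^2 d) operations
    per element.

    The equation is solved by doubling the precision of G and 1 / G ([compute_ode]). A product
    modulo (s^n, y^d) is one univariate product after Kronecker substitution ([compute_bimul]), of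
    cost O(n d log d) for n <= d; these costs form a geometric series along the doubling, so that a
    factor costs O(d^2 log d) besides the product trees ([compute_factor]), which is within d^(r+1)
    log d as r >= 1.

    Since y_i^k occurs in no term of order less than k in s, gtd_n with n < d only has monomials of
    total degree < d ([gtdE]), at most d^r of them. The coefficient of each is read off a product of
    r + 1 univariate series ([gtd_coef]), that is, r fast multiplications. The divisions by n <= d
    are legitimate because the characteristic is 0 or exceeds d. *)

Section Calculus.
Local Open Scope ring_scope.
(* The values depend on an instance x : X, on which the program itself does *)
(* not depend; a state lists the contents of the registers.                 *)
Variables (R : fieldType) (K : pred R) (X : Type).
Local Notation F := (X -> R).
Implicit Types (s t : seq F) (f g : F) (P : slp R).

Definition mem_at s (x : X) : seq R := [seq f x | f <- s].

Definition avail s f :=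
  exists o : operand R, forall x, read K (mem_at s x) o = Some (f x).

Definition extends s t := exists u, t = s ++ u.

(** P and t are chosen before x: a single program serves all instances. Costs add up under
    [compute_bind], so algorithms are written as chains of such judgements. *)
Definition compute s (N : nat) (Q : seq F -> Prop) :=
  exists P t, [/\ (size P <= N)%N, extends s t,
    forall x, exec K P (mem_at s x) = Some (mem_at t x) & Q t].

Definition stable (Q : seq F -> Prop) :=
  forall s t, extends s t -> Q s -> Q t.

Lemma extends_refl s : extends s s.
Proof. by exists [::]; rewrite cats0. Qed.

Lemma extends_trans t s u : extends s t -> extends t u -> extends s u.
Proof. by move=> [s1 ->] [s2 ->]; exists (s1 ++ s2); rewrite catA. Qed.

Lemma avail_ext s t f : extends s t -> avail s f -> avail t f.
Proof.
move=> [u ->] [o ho]; exists o => x; rewrite /mem_at map_cat -/(mem_at s x).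
case: o ho => [i|c] /(_ x) //= hi; rewrite onth_cat.
by rewrite -onthTE hi.
Qed.

Lemma avail_stable f : stable (avail^~ f).
Proof. by move=> s t; apply: avail_ext. Qed.

Lemma avail_eq s f g : f =1 g -> avail s f -> avail s g.
Proof. by move=> fg [o ho]; exists o => x; rewrite ho fg. Qed.

Lemma avail0 s : avail s (fun=> 0).
Proof. by exists (Cst 0) => x /=; rewrite eqxx. Qed.

Lemma avail1 s : avail s (fun=> 1).
Proof. by exists (Cst 1) => x /=; rewrite eqxx orbT. Qed.

Lemma avail_nth s i : avail s (nth (fun=> 0) s i).
Proof.
have [lt_is|le_si] := ltnP i (size s); last by rewrite nth_default //; apply: avail0.
exists (Reg R i) => x /=.
by rewrite onth_map -(odflt_onth (fun=> 0)); case: (onth s i) (onthTE s i); rewrite lt_is.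
Qed.

Lemma compute_ret s N (Q : seq F -> Prop) : Q s -> compute s N Q.
Proof. by exists [::], s; split=> //; apply: extends_refl. Qed.

Lemma exec_cat P1 P2 (m : seq R) :
  exec K (P1 ++ P2) m = obind (exec K P2) (exec K P1 m).
Proof.
by elim: P1 m => //= c P1 IH m; case: (eval K m c) => //=.
Qed.

Lemma compute_bind s M N (Q Q' : seq F -> Prop) :
  compute s M Q -> (forall t, extends s t -> Q t -> compute t N Q') ->
  compute s (M + N) Q'.
Proof.
move=> [P1 [t [c1 st e1 Qt]]] /(_ t st Qt) [P2 [u [c2 tu e2 Qu]]].
exists (P1 ++ P2), u; split=> //; first by rewrite size_cat leq_add.
  exact: extends_trans tu.
by move=> x; rewrite exec_cat e1 /= e2.
Qed.

Lemma compute_le s M N (Q Q' : seq F -> Prop) :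
  compute s M Q -> (M <= N)%N -> (forall t, extends s t -> Q t -> Q' t) ->
  compute s N Q'.
Proof.
move=> [P [t [c st e Qt]]] leMN QQ'; exists P, t; split=> //.
  exact: leq_trans leMN.
exact: QQ'.
Qed.

Lemma compute_instr s (c : instr R) g :
  (forall x, eval K (mem_at s x) c = Some (g x)) ->
  compute s 1 (avail^~ g).
Proof.
move=> eg; exists [:: c], (rcons s g); split=> //.
- by exists [:: g]; rewrite cats1.
- by move=> x /=; rewrite eg /= /mem_at map_rcons.
apply: avail_eq (avail_nth (rcons s g) (size s)) => x.
by rewrite nth_rcons ltnn eqxx.
Qed.

Lemma compute_add s f g : avail s f -> avail s g ->
  compute s 1 (avail^~ (fun x => f x + g x)).
Proof.
move=> [o ho] [o' ho']; apply: (@compute_instr _ (Add o o')) => x.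
by rewrite /= /read2 ho ho'.
Qed.

Lemma compute_sub s f g : avail s f -> avail s g ->
  compute s 1 (avail^~ (fun x => f x - g x)).
Proof.
move=> [o ho] [o' ho']; apply: (@compute_instr _ (Defs.Sub o o')) => x.
by rewrite /= /read2 ho ho'.
Qed.

Lemma compute_mul s f g : avail s f -> avail s g ->
  compute s 1 (avail^~ (fun x => f x * g x)).
Proof.
move=> [o ho] [o' ho']; apply: (@compute_instr _ (Mul o o')) => x.
by rewrite /= /read2 ho ho'.
Qed.

Lemma compute_div s f g : avail s f -> avail s g -> (forall x, g x != 0) ->
  compute s 1 (avail^~ (fun x => f x / g x)).
Proof.
move=> [o ho] [o' ho'] g0; apply: (@compute_instr _ (Div o o')) => x.
by rewrite /= /read2 ho ho' /= (negPf (g0 x)).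
Qed.

Lemma compute_all s (I : eqType) (l : seq I) (N : I -> nat)
    (Q : I -> seq F -> Prop) :
  (forall i, i \in l -> stable (Q i)) ->
  (forall i t, i \in l -> extends s t -> compute t (N i) (Q i)) ->
  compute s (\sum_(i <- l) N i) (fun t => forall i, i \in l -> Q i t).
Proof.
elim: l s => [|i l IH] s stQ cQ; first exact: compute_ret.
rewrite big_cons; apply: (compute_bind (Q := Q i)).
  by apply: cQ; rewrite ?mem_head //; apply: extends_refl.
move=> t st Qi; apply: compute_le (IH t _ _) (leqnn _) _.
- by move=> j lj; apply: stQ; rewrite inE lj orbT.
- move=> j u lj tu; apply: cQ; first by rewrite inE lj orbT.
  exact: extends_trans tu.
move=> u tu Ql j; rewrite inE => /orP [/eqP->|]; last exact: Ql.
by apply: stQ tu Qi; rewrite mem_head.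
Qed.

Lemma compute_nat s (n M : nat) (Q : nat -> seq F -> Prop) :
  (forall i, (i < n)%N -> stable (Q i)) ->
  (forall i t, (i < n)%N -> extends s t -> compute t M (Q i)) ->
  compute s (n * M)%N (fun t => forall i, (i < n)%N -> Q i t).
Proof.
move=> stQ cQ; have hin i : (i \in iota 0 n) = (i < n)%N by rewrite mem_iota.
apply: compute_le (compute_all (l := iota 0 n) (N := fun=> M) _ _) _ _.
- by move=> i; rewrite hin; apply: stQ.
- by move=> i t; rewrite hin; apply: cQ.
- by rewrite big_const_seq count_predT size_iota iter_addn_0 mulnC.
by move=> t _ Qt i lt_in; apply: Qt; rewrite hin.
Qed.

Lemma compute_nat2 s (n e M : nat) (f : nat -> nat -> F) :
  (forall i j t, (i < n)%N -> (j < e)%N -> extends s t ->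
     compute t M (avail^~ (f i j))) ->
  compute s (n * e * M)%N
    (fun t => forall i j, (i < n)%N -> (j < e)%N -> avail t (f i j)).
Proof.
move=> cf; rewrite -mulnA.
apply: compute_le (compute_nat
  (Q := fun i t => forall j, (j < e)%N -> avail t (f i j)) _ _) (leqnn _) _.
- by move=> i _ t u tu Q j /Q; apply: avail_ext.
- move=> i t lt_in st; apply: compute_nat => [j _|j u lt_je tu].
    exact: avail_stable.
  by apply: cf => //; apply: extends_trans tu.
by move=> t _ Q i j ? ?; apply: Q.
Qed.

Definition operand_value (regs : seq F) (o : operand R) : F :=
  match o with
  | Reg i => nth (fun=> 0) regs i
  | Cst c => fun=> if [|| c == 0, c == 1 | K c] then c else 0
  end.

Lemma avail_operand_value s regs o :
  (forall i, avail s (nth (fun=> 0) regs i)) -> avail s (operand_value regs o).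
Proof.
move=> h; case: o => [i|c] /=; first exact: h.
case: ifP => hc; last exact: avail0.
by exists (Cst c) => x /=; rewrite hc.
Qed.

Lemma read_operand_value regs o x v :
  read K (mem_at regs x) o = Some v -> v = operand_value regs o x.
Proof.
case: o => [i|c] /=; last by case: ifP => // _ [].
by rewrite onth_map -(odflt_onth (fun=> 0)); case: (onth regs i) => //= f [].
Qed.

(* The values read by P need not be laid out as in the state it was written *)
(* for: its instructions are renumbered.                                    *)
Lemma compute_exec P s regs :
  (forall i, avail s (nth (fun=> 0) regs i)) ->
  (forall x, exec K P (mem_at regs x) != None) ->
  exists2 regs', forall x, exec K P (mem_at regs x) = Some (mem_at regs' x) &
  compute s (size P) (fun t => forall i, avail t (nth (fun=> 0) regs' i)).
Proof.
elim: P s regs => [|c P IH] s regs hregs hP.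
  by exists regs => //; apply: compute_ret.
have [g gE cg] : exists2 g, forall x, eval K (mem_at regs x) c = Some (g x)
                     & compute s 1 (avail^~ g).
  have hE x : eval K (mem_at regs x) c != None.
    by move: (hP x) => /=; case: eval.
  case: c {hP} hE => o o' hE;
  [ exists (fun x => operand_value regs o x + operand_value regs o' x)
  | exists (fun x => operand_value regs o x - operand_value regs o' x)
  | exists (fun x => operand_value regs o x * operand_value regs o' x)
  | exists (fun x => operand_value regs o x / operand_value regs o' x) ];
  try by [ move=> x; move: (hE x); rewrite /= /read2;
    case eu: (read K _ o) => [u|] //=; case ev: (read K _ o') => [v|] //=;
    rewrite (read_operand_value eu) (read_operand_value ev) //;
    case: ifP; rewrite ?eqxx
  | apply: compute_add; apply: avail_operand_value
  | apply: compute_sub; apply: avail_operand_value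
  | apply: compute_mul; apply: avail_operand_value ].
  apply: compute_div => [||x]; try exact: avail_operand_value.
  move: (hE x); rewrite /= /read2.
  case eu: (read K _ o) => [u|] //=; case ev: (read K _ o') => [v|] //=.
  by rewrite (read_operand_value ev); case: ifP => //; rewrite eqxx.
have memE x : mem_at (rcons regs g) x = rcons (mem_at regs x) (g x).
  by rewrite /mem_at map_rcons.
case: cg => Pg [t [sPg st eg avg]].
have hregs' i : avail t (nth (fun=> 0) (rcons regs g) i).
  rewrite nth_rcons; case: ltnP => _; first exact: avail_ext st _.
  by case: eqP => _ //; apply: avail0.
have hP' x : exec K P (mem_at (rcons regs g) x) != None.
  by move: (hP x); rewrite /= gE memE.
have [regs' eregs' cregs'] := IH t _ hregs' hP'.
exists regs'; first by move=> x; rewrite /= gE /= -memE.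
rewrite /= -add1n; apply: (compute_bind (Q := fun u => u = t)).
  by exists Pg, t; split.
by move=> u _ ->.
Qed.

Lemma compute_program P (o : nat -> operand R) s (ins : seq F) n (f : nat -> F) :
  (forall i, avail s (nth (fun=> 0) ins i)) ->
  (forall x k, (k < n)%N -> output K P (mem_at ins x) (o k) = Some (f k x)) ->
  (0 < n)%N ->
  compute s (size P) (fun t => forall k, (k < n)%N -> avail t (f k)).
Proof.
move=> hins ho n0.
(* A defined output forces P to run to its end; this is where at least one output is needed. *)
have hP x : exec K P (mem_at ins x) != None.
  by move: (ho x 0 n0); rewrite /output; case: exec.
have [regs eregs cregs] := compute_exec hins hP.
apply: compute_le cregs (leqnn _) _ => t _ ht k lt_kn.
apply: avail_eq (avail_operand_value (o k) ht) => x.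
move: (ho x k lt_kn); rewrite /output eregs /= => /read_operand_value.
by move->.
Qed.

End Calculus.

(** * Fast multiplication modulo (s^n, y^e) *)

Section Congruence.
Local Open Scope ring_scope.
Variable R : comNzRingType.
Local Notation bipoly := {poly {poly R}}.
Implicit Types p q u v : bipoly.

(* Membership in the ideal (s^n, y^e) of R[y][s]. *)
Definition small (n e : nat) p :=
  forall i j, (i < n)%N -> (j < e)%N -> p`_i`_j = 0.

Lemma smallD n e p q : small n e p -> small n e q -> small n e (p + q).
Proof. by move=> hp hq i j ? ?; rewrite !coefD hp ?hq ?addr0. Qed.

Lemma smallN n e p : small n e p -> small n e (- p).
Proof. by move=> hp i j ? ?; rewrite !coefN hp ?oppr0. Qed.

Lemma smallB n e p q : small n e p -> small n e q -> small n e (p - q).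
Proof. by move=> hp hq; apply: smallD => //; apply: smallN. Qed.

Lemma small_le n n' e p : (n <= n')%N -> small n' e p -> small n e p.
Proof. by move=> le hp i j ? ?; apply: hp => //; lia. Qed.

Lemma smallMM k l n e p q : (n <= k + l)%N ->
  small k e p -> small l e q -> small n e (p * q).
Proof.
move=> le_n hp hq i j lt_in lt_je; rewrite coefM coef_sum big1 // => a _.
rewrite coefM big1 // => b _.
have [lt_ak|le_ka] := ltnP a k.
  by rewrite hp ?mul0r //; have := ltn_ord b; lia.
have [lt_l|] := ltnP (i - a) l; first by rewrite (hq _ _ lt_l) ?mulr0 //; lia.
by have := ltn_ord a; lia.
Qed.

Lemma smallMr n e p q : small n e p -> small n e (p * q).
Proof. by move=> hp; apply: (@smallMM n 0) => //; lia. Qed.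

Lemma smallMl n e p q : small n e q -> small n e (p * q).
Proof. by move=> hp; rewrite mulrC; apply: smallMr. Qed.

Lemma small_coefE n e p q i j : small n e (p - q) ->
  (i < n)%N -> (j < e)%N -> p`_i`_j = q`_i`_j.
Proof.
by move=> h lt_in lt_je; apply/eqP; rewrite -subr_eq0 -!coefB h.
Qed.

Definition bitrunc n e p : bipoly := \poly_(i < n) take_poly e p`_i.

Lemma coef_bitrunc n e p i j :
  (bitrunc n e p)`_i`_j = if (i < n)%N && (j < e)%N then p`_i`_j else 0.
Proof.
rewrite coef_poly; case: ltnP => _ /=; last by rewrite coef0.
by rewrite coef_take_poly.
Qed.

Lemma small_bitrunc n e p : small n e (p - bitrunc n e p).
Proof. by move=> i j ? ?; rewrite !coefB coef_bitrunc; case: ifP; lia || rewrite subrr. Qed.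

(** The coefficients of p are digits in base y^m: having size at most m, they occupy disjoint blocks
    after the substitution s := y^m. *)
Lemma coef_kronecker (m : nat) p i j : (0 < m)%N ->
  (forall k, (size (p`_k)%R <= m)%N) -> (j < m)%N ->
  (p.['X^m])`_(m * i + j) = p`_i`_j.
Proof.
move=> m0; elim/poly_ind: p i => [|p c IH] i szp ltjm.
  by rewrite horner0 !coef0.
have szp' k : (size (p`_k)%R <= m)%N.
  by move: (szp k.+1); rewrite coefD coefMX coefC /= addr0.
have szc : (size c <= m)%N.
  by move: (szp 0%N); rewrite coefD coefMX coefC /= add0r.
rewrite hornerD hornerMX hornerC coefD coefMXn coefD coefMX coefC.
case: i => [|i] /=; first by rewrite muln0 add0n ltjm !add0r.
rewrite addr0 mulnS -addnA ltnNge leq_addr /= addKn -IH //.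
by rewrite [c`_ _]nth_default ?addr0 // (leq_trans szc) ?leq_addr.
Qed.

Lemma coefM_take n (p q : {poly R}) k : (k < n)%N ->
  (take_poly n p * take_poly n q)`_k = (p * q)`_k.
Proof.
move=> lt_kn; rewrite !coefM; apply: eq_bigr => i _.
by rewrite !coef_take_poly !ifT //; have := ltn_ord i; lia.
Qed.

End Congruence.

(** * Cost of products modulo s^n and modulo (s^n, y^e) *)

Section Series.
Local Open Scope ring_scope.
Variables (R : fieldType) (K : pred R) (X : Type) (C0 : nat).
Hypothesis fastK : fast_multiplication K C0.
Local Notation F := (X -> R).
Local Notation bipoly := {poly {poly R}}.
Local Notation avail := (avail K).
Local Notation compute := (compute K).
Implicit Types (s t : seq F) (u v : X -> bipoly).

Definition known1 n (f : X -> {poly R}) s :=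
  forall i, (i < n)%N -> avail s (fun x => (f x)`_i).

Definition known n e u s :=
  forall i j, (i < n)%N -> (j < e)%N -> avail s (fun x => (u x)`_i`_j).

Lemma known_ext n e u s t : extends s t -> known n e u s -> known n e u t.
Proof. by move=> st h i j ? ?; apply: avail_ext st _; apply: h. Qed.

Lemma known1_ext n f s t : extends s t -> known1 n f s -> known1 n f t.
Proof. by move=> st h i ?; apply: avail_ext st _; apply: h. Qed.

Lemma known_small n e u v s : (forall x, small n e (u x - v x)) ->
  known n e u s -> known n e v s.
Proof.
move=> uv h i j lt_in lt_je; apply: avail_eq (h i j lt_in lt_je) => x.
exact: small_coefE (uv x) _ _.
Qed.

Lemma compute_mul1 n f g s : (1 < n)%N -> known1 n f s -> known1 n g s ->
  compute s (C0 * (n * trunc_log 2 n))%N (known1 n (fun x => f x * g x)).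
Proof.
move=> n1 hf hg; have [P [o [costP hP]]] := fastK n1.
pose ins (h : X -> {poly R}) := mkseq (fun i x => (take_poly n (h x))`_i) n.
have insE h x : mem_at (ins h) x = mkseq (nth 0 (take_poly n (h x))) n.
  by rewrite /mem_at /ins /mkseq -map_comp.
have av h i : known1 n h s -> avail s (nth (fun=> 0) (ins h) i).
  move=> hh; have [lt_in|le_ni] := ltnP i n.
    rewrite nth_mkseq //; apply: avail_eq (hh i lt_in) => x.
    by rewrite coef_take_poly lt_in.
  by rewrite nth_default ?size_mkseq //; apply: avail0.
apply: compute_le (compute_program (P := P) (o := o) (n := n)
  (ins := ins f ++ ins g) (f := fun k x => (f x * g x)`_k) _ _ _) costP _ => //.
- by move=> i; rewrite nth_cat; case: ifP => _; apply: av.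
- move=> x k lt_kn; rewrite /mem_at map_cat -!/(mem_at _ x) !insE.
  rewrite hP ?size_take_poly //; last by lia.
  by rewrite coefM_take.
by lia.
Qed.

(** After truncation the coefficients in y have size at most e, and those of the product at most 2
    e. The substitution s := y^(2 e) is thus faithful on the factors and on the product, and leaves
    one product of polynomials of size at most 2 e n. *)
Lemma compute_bimul n e u v s : (0 < n)%N -> (0 < e)%N ->
  known n e u s -> known n e v s ->
  compute s (C0 * (2 * e * n * trunc_log 2 (2 * e * n)))%N
    (known n e (fun x => u x * v x)).
Proof.
move=> n0 e0 hu hv; pose m := (2 * e)%N.
have m0 : (0 < m)%N by rewrite /m; lia.
have szt (w : bipoly) k : (size ((bitrunc n e w)`_k)%R <= e)%N.
  rewrite coef_poly; case: ifP => _; last by rewrite size_poly0.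
  exact: size_take_poly.
have hk w : known n e w s ->
    known1 (m * n) (fun x => (bitrunc n e (w x)).['X^m]) s.
  move=> hw k lt_k; have kE : k = (m * (k %/ m) + k %% m)%N.
    by rewrite mulnC -divn_eq.
  case: (boolP ((k %/ m < n)%N && (k %% m < e)%N)) => [hin|hout].
    have [lt1 lt2] := andP hin.
    apply: avail_eq (hw _ _ lt1 lt2) => x; rewrite {3}kE coef_kronecker //.
    - by rewrite coef_bitrunc hin.
    - by move=> i; apply: leq_trans (szt _ _) _; rewrite /m; lia.
    - by rewrite ltn_mod.
  apply: avail_eq (avail0 K s) => x; rewrite kE coef_kronecker //.
  - by rewrite coef_bitrunc (negPf hout).
  - by move=> i; apply: leq_trans (szt _ _) _; rewrite /m; lia.
  - by rewrite ltn_mod.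
have mn : (1 < m * n)%N by rewrite /m; nia.
apply: compute_le (compute_mul1 mn (hk u hu) (hk v hv)) (leqnn _) _ => t _ ht.
apply: (known_small
  (u := fun x => bitrunc n e (u x) * bitrunc n e (v x))) => [x|].
  set u' := bitrunc _ _ _; set v' := bitrunc _ _ _.
  have -> : u' * v' - u x * v x =
     - (u' * (v x - v')) - (u x - u') * v x by ring.
  apply: smallB; first apply: smallN.
    by apply: smallMl; apply: small_bitrunc.
  by apply: smallMr; apply: small_bitrunc.
move=> i j lt_in lt_je; apply: avail_eq (ht (m * i + j)%N _) => [x|]; last first.
  by rewrite /m; nia.
rewrite -hornerM coef_kronecker //; last by rewrite /m; lia.
move=> k; rewrite coefM; apply: (big_ind (fun p : {poly R} => (size p <= m)%N)).
- by rewrite size_poly0.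
- by move=> p q hp hq; rewrite (leq_trans (size_polyD _ _)) // geq_max hp.
move=> a _; apply: leq_trans (size_polyMleq _ _) _.
by apply: leq_trans (leq_pred _) _; rewrite /m mul2n -addnn leq_add ?szt.
Qed.

End Series.

(** * Newton iteration *)

Section Euler.
Local Open Scope ring_scope.
Variable A : comNzRingType.
Implicit Types p q : {poly A}.

Definition euler p : {poly A} := 'X * p^`().

Lemma coef_euler p n : (euler p)`_n = p`_n *+ n.
Proof. by rewrite coefXM coef_deriv; case: n. Qed.

Lemma eulerM p q : euler (p * q) = euler p * q + p * euler q.
Proof. by rewrite /euler derivM; ring. Qed.

Lemma eulerB p q : euler (p - q) = euler p - euler q.
Proof. by rewrite /euler derivB mulrBr. Qed.

Lemma euler1 : euler 1 = 0.
Proof. by rewrite /euler derivC mulr0. Qed.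

End Euler.

Lemma small_euler (R : comNzRingType) n e (p : {poly {poly R}}) :
  small n e p -> small n e (euler p).
Proof. by move=> h i j ? ?; rewrite coef_euler coefMn h ?mul0rn. Qed.

(** * Inversion and solution of theta G = W G by doubling the precision *)

Section Newton.
Local Open Scope ring_scope.
Variables (R : fieldType) (K : pred R) (X : Type) (C0 d q : nat).
Hypothesis fastK : fast_multiplication K C0.
Hypothesis d0 : (0 < d)%N.
Hypothesis q0 : (0 < q)%N.
Hypothesis costM : forall n, (0 < n <= d)%N ->
  (C0 * (2 * d * n * trunc_log 2 (2 * d * n)) <= n * d * q)%N.
Hypothesis natR : forall n, (0 < n <= d)%N -> n%:R != 0 :> R.
Local Notation F := (X -> R).
Local Notation bipoly := {poly {poly R}}.
Local Notation avail := (avail K).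
Local Notation compute := (compute K).
Local Notation known n u := (known K n d u).
Implicit Types (s t : seq F) (u v W G H : X -> bipoly).

Definition known_nats s := forall n, (n <= d)%N -> avail s (fun=> n%:R).

Lemma known_nats_ext s t : extends s t -> known_nats s -> known_nats t.
Proof. by move=> st h n ?; apply: avail_ext st _; apply: h. Qed.

Lemma compute_nats s : compute s d known_nats.
Proof.
suff: forall m, compute s m
    (fun t => forall n, (n <= m)%N -> avail t (fun=> n%:R)) by apply.
elim=> [|m IH].
  apply: compute_ret => n; rewrite leqn0 => /eqP ->; exact: avail0.
rewrite -addn1; apply: compute_bind IH _ => t st ht.
apply: compute_le (compute_add (ht m (leqnn m)) (avail1 _ _)) (leqnn _) _.
move=> u tu hu n; rewrite addn1 leq_eqVlt => /orP [/eqP ->|lt_nm].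
  by apply: avail_eq hu => x; rewrite -natr1.
by apply: avail_ext tu _; apply: ht.
Qed.

(** Bounds one product modulo (s^n, y^d), q absorbing the logarithm. The order in y stays at d, so
    the bound is linear in n and sums geometrically when n is doubled. *)
Definition mulcost n := (n * d * q)%N.

Lemma leq_mulcost n : (n * d * 1 <= mulcost n)%N.
Proof. by rewrite leq_mul. Qed.

Lemma compute_bi_mul n u v s : (0 < n <= d)%N ->
  known n u s -> known n v s ->
  compute s (mulcost n) (known n (fun x => u x * v x)).
Proof.
move=> nd hu hv; have /andP [n0 _] := nd.
by apply: compute_le (compute_bimul fastK n0 d0 hu hv) (costM nd) _.
Qed.

Lemma compute_bi_sub n u v s : known n u s -> known n v s ->
  compute s (mulcost n) (known n (fun x => u x - v x)).
Proof.
move=> hu hv; apply: compute_le (compute_nat2 (n := n) (e := d)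
  (f := fun i j x => (u x)`_i`_j - (v x)`_i`_j) _) (leq_mulcost n) _.
  move=> i j t ? ? st.
  by apply: compute_sub; apply: avail_ext st _; [apply: hu|apply: hv].
move=> t _ h i j lt_in lt_je.
by apply: avail_eq (h i j lt_in lt_je) => x; rewrite !coefB.
Qed.

Lemma compute_bi_add n u v s : known n u s -> known n v s ->
  compute s (mulcost n) (known n (fun x => u x + v x)).
Proof.
move=> hu hv; apply: compute_le (compute_nat2 (n := n) (e := d)
  (f := fun i j x => (u x)`_i`_j + (v x)`_i`_j) _) (leq_mulcost n) _.
  move=> i j t ? ? st.
  by apply: compute_add; apply: avail_ext st _; [apply: hu|apply: hv].
move=> t _ h i j lt_in lt_je.
by apply: avail_eq (h i j lt_in lt_je) => x; rewrite !coefD.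
Qed.

Lemma compute_bi_euler n u s : (n <= d)%N -> known_nats s -> known n u s ->
  compute s (mulcost n) (known n (fun x => euler (u x))).
Proof.
move=> le_nd hN hu; apply: compute_le (compute_nat2 (n := n) (e := d)
  (f := fun i j x => i%:R * (u x)`_i`_j) _) (leq_mulcost n) _.
  move=> i j t lt_in lt_jd st.
  apply: compute_mul; apply: avail_ext st _; last exact: hu.
  by apply: hN; lia.
move=> t _ h i j lt_in lt_je; apply: avail_eq (h i j lt_in lt_je) => x.
by rewrite coef_euler coefMn mulr_natl.
Qed.

(* Inverts euler on the series without constant term; the coefficient of *)
(* s^0 of the result is 0, because 0^-1 = 0.                             *)
Definition euler_inv n (p : bipoly) : bipoly :=
  \poly_(i < n) ((i%:R : R)^-1 *: p`_i).

Lemma compute_bi_euler_inv n u s : (n <= d)%N -> known_nats s -> known n u s ->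
  compute s (mulcost n) (known n (fun x => euler_inv n (u x))).
Proof.
move=> le_nd hN hu; apply: compute_le (compute_nat2 (n := n) (e := d)
  (f := fun i j x => (u x)`_i`_j / i%:R) _) (leq_mulcost n) _.
  move=> i j t lt_in lt_jd st; have hu' := avail_ext st (hu i j lt_in lt_jd).
  have [->|i0] := posnP i.
    by apply: compute_ret; apply: avail_eq (avail0 _ _) => x; rewrite invr0 mulr0.
  apply: compute_div => //; last by move=> _; apply: natR; lia.
  by apply: avail_ext st _; apply: hN; lia.
move=> t _ h i j lt_in lt_je; apply: avail_eq (h i j lt_in lt_je) => x.
by rewrite coef_poly lt_in coefZ mulrC.
Qed.

Lemma known_bitrunc k n u s : known k u s ->
  known n (fun x => bitrunc k d (u x)) s.
Proof.
move=> hu i j lt_in lt_jd; have [lt_ik|le_ki] := ltnP i k.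
  apply: avail_eq (hu i j lt_ik lt_jd) => x.
  by rewrite coef_bitrunc lt_ik lt_jd.
by apply: avail_eq (avail0 _ _) => x; rewrite coef_bitrunc ltnNge le_ki.
Qed.

Lemma known1s n s : known n (fun=> 1) s.
Proof.
move=> i j _ _; have [i0|i0] := eqVneq i 0%N; last first.
  by apply: avail_eq (avail0 _ _) => x; rewrite coef1 (negPf i0) coef0.
have [j0|j0] := eqVneq j 0%N.
  by apply: avail_eq (avail1 _ _) => x; rewrite i0 j0 !coef1.
by apply: avail_eq (avail0 _ _) => x; rewrite i0 !coef1 (negPf j0).
Qed.

Lemma known_le n n' u s : (n <= n')%N -> known n' u s -> known n u s.
Proof. by move=> le h i j ? ?; apply: h => //; lia. Qed.

(* If v h = 1 and u agrees with h to order k, then u (2 - v u) agrees with h *)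
(* to order 2 k.                                                           *)
Lemma compute_inv_step k l (v h : X -> bipoly) s : (0 < l <= d)%N -> (l <= k + k)%N ->
  (forall x, small l d (v x * h x - 1)) ->
  known l v s -> known k h s ->
  compute s (4 * mulcost l) (known l h).
Proof.
move=> ld lk vh1 hv hh; have hl : (l <= d)%N by lia.
pose u x := bitrunc k d (h x).
have hu : known l u s by apply: known_bitrunc.
rewrite !mulSn mul0n addn0.
apply: compute_bind (compute_bi_mul ld hv hu) _ => t1 st1 h1.
have hu1 := known_ext st1 hu.
apply: compute_bind (compute_bi_sub (@known1s l t1) h1) _ => t2 st2 h2.
have hu2 := known_ext st2 hu1.
apply: compute_bind (compute_bi_mul ld hu2 h2) _ => t3 st3 h3.
have hu3 := known_ext st3 hu2.
apply: compute_le (compute_bi_add hu3 h3) (leqnn _) _ => t4 _ h4.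
apply: known_small h4 => x; set U := u x; set V := v x; set H := h x.
have -> : U + U * (1 - V * U) - H =
    (V * H - 1) * (V * U ^+ 2 - 2%:R * U) - H * (1 - V * U) ^+ 2 by ring.
have hUV : small (minn k l) d (1 - V * U).
  have -> : 1 - V * U = V * (H - U) - (V * H - 1) by ring.
  apply: smallB; last by apply: small_le (vh1 x); apply: geq_minr.
  by apply: smallMl; apply: small_le (@small_bitrunc _ k d H); apply: geq_minl.
apply: smallB; first by apply: smallMr; apply: vh1.
by apply: smallMl; apply: (smallMM _ hUV hUV); lia.
Qed.

(* With u and h the truncations of G and H at order k, the approximation to *)
(* order 2 k is u (1 + theta^-1 (h (W u - theta u))).                       *)
Lemma compute_ode_step k l W G H s : (0 < k)%N -> (0 < l <= d)%N ->
  (l <= k + k)%N ->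
  (forall x, small l d (G x * H x - 1)) ->
  (forall x, small l d (euler (G x) - W x * G x)) ->
  known_nats s -> known l W s -> known k G s -> known k H s ->
  compute s (7 * mulcost l) (known l G).
Proof.
move=> k0 ld lk GH1 ode hN hW hG hH; have hl : (l <= d)%N by lia.
pose u x := bitrunc k d (G x); pose h x := bitrunc k d (H x).
have hu : known l u s by apply: known_bitrunc.
have hh : known l h s by apply: known_bitrunc.
rewrite !mulSn mul0n addn0.
apply: compute_bind (compute_bi_mul ld hW hu) _ => t1 s1 h1.
have hu1 := known_ext s1 hu; have hh1 := known_ext s1 hh.
have hN1 := known_nats_ext s1 hN.
apply: compute_bind (compute_bi_euler hl hN1 hu1) _ => t2 s2 h2.
have hu2 := known_ext s2 hu1; have hh2 := known_ext s2 hh1.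
have hN2 := known_nats_ext s2 hN1; have h12 := known_ext s2 h1.
apply: compute_bind (compute_bi_sub h12 h2) _ => t3 s3 h3.
have hu3 := known_ext s3 hu2; have hh3 := known_ext s3 hh2.
have hN3 := known_nats_ext s3 hN2.
apply: compute_bind (compute_bi_mul ld hh3 h3) _ => t4 s4 h4.
have hu4 := known_ext s4 hu3; have hN4 := known_nats_ext s4 hN3.
apply: compute_bind (compute_bi_euler_inv hl hN4 h4) _ => t5 s5 h5.
have hu5 := known_ext s5 hu4.
apply: compute_bind (compute_bi_mul ld hu5 h5) _ => t6 s6 h6.
have hu6 := known_ext s6 hu5.
apply: compute_le (compute_bi_add hu6 h6) (leqnn _) _ => t7 _ h7.
apply: known_small h7 => x.
set U := u x; set Y := h x; set E := W x * U - euler U.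
set V := euler_inv l (Y * E); pose D := G x - U.
pose m := minn k l.
have Dk : small m d D by apply: small_le (@small_bitrunc _ k d _); apply: geq_minl.
have Yk : small m d (H x - Y).
  by apply: small_le (@small_bitrunc _ k d _); apply: geq_minl.
have Gm : small m d (euler (G x) - W x * G x).
  by apply: small_le (ode x); apply: geq_minr.
have EE : E = euler D - W x * D - (euler (G x) - W x * G x).
  by rewrite /D eulerB /E; ring.
have Em : small m d E.
  rewrite EE; apply: smallB => //; apply: smallB; first exact: small_euler.
  exact: smallMl.
have lm : (l <= m + m)%N by rewrite /m; lia.
(* H (theta D - W D) is theta (D H) because theta H = - W H. *)
have hYE : small l d (euler (D * H x) - Y * E).
  have -> : euler (D * H x) - Y * E =
      (H x - Y) * E + H x * (euler (G x) - W x * G x)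
      + D * (H x * euler (G x * H x - 1)
             - H x ^+ 2 * (euler (G x) - W x * G x)
             - (euler (H x) + H x * W x) * (G x * H x - 1)).
    by rewrite EE (eulerB (G x * H x)) euler1 !eulerM; ring.
  have s1' : small l d (euler (G x * H x - 1)) by apply: small_euler.
  apply: smallD; first apply: smallD.
  - exact: (smallMM lm Yk Em).
  - exact: smallMl.
  - apply: smallMl; apply: smallB; last exact: smallMl.
    by apply: smallB; apply: smallMl.
have hV : small l d (D * H x - V).
  move=> i j lt_il lt_jd; rewrite !coefB coef_poly lt_il coefZ.
  have /eqP := hYE i j lt_il lt_jd.
  rewrite !coefB coef_euler coefMn subr_eq0 => /eqP <-.
  (* At order 0 the value 0^-1 = 0 makes V_0 = 0, the right value since D vanishes to order m >
     0. *)
  have [i0|i0] := posnP i.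
    rewrite i0 invr0 mul0r subr0 -i0; apply: (@smallMr _ m d D) => //.
    by rewrite i0 /m; lia.
  by rewrite -[_`_j *+ i]mulr_natl mulKf ?subrr //; apply: natR; lia.
(* As V is D H to order l, the remaining error is -D^2 H, quadratic in D. *)
have -> : U + U * V - G x = - U * (D * H x - V) - D * (D * H x)
     + D * (G x * H x - 1) by rewrite /D; ring.
apply: smallD; last exact: smallMl.
apply: smallB; first exact: smallMl.
by rewrite mulrA; apply: smallMr; apply: (smallMM lm Dk Dk).
Qed.

Lemma known1_const (h : X -> bipoly) s : (forall x, small 1 d (h x - 1)) -> known 1 h s.
Proof.
move=> h1; apply: (@known_small _ _ _ _ _ (fun=> 1)) => [x|].
  by rewrite -opprB; apply: smallN.
exact: known1s.
Qed.

Lemma small_inv1 n (v h : bipoly) : (0 < n)%N -> small n d (v * h - 1) ->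
  small 1 d (v - 1) -> small 1 d (h - 1).
Proof.
move=> n0 vh v1; have -> : h - 1 = (v * h - 1) - (v - 1) * h by ring.
by apply: smallB; [apply: small_le vh|apply: smallMr].
Qed.

(** The constant term 1 is free, and reaching order l from order uphalf l costs 4 l d q. The bound
    16 d q (l - 1) solves this recurrence because 4 (uphalf l - 1) + l <= 4 (l - 1) for l >= 2. *)
Lemma compute_inv (v h : X -> bipoly) s :
  (forall x, small d d (v x * h x - 1)) -> (forall x, small 1 d (v x - 1)) ->
  known d v s -> compute s (16 * mulcost d) (known d h).
Proof.
move=> vh v1 hv.
have h1 x : small 1 d (h x - 1) by apply: small_inv1 (vh x) (v1 x).
suff: forall l, (0 < l <= d)%N ->
    compute s (16 * (d * q * l.-1)) (known l h).
  move=> /(_ d); rewrite d0 leqnn => /(_ isT) hd.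
  by apply: compute_le hd _ _ => //; rewrite /mulcost; nia.
elim/ltn_ind=> l IH ld; have [l1|l1] := leqP l 1.
  have -> : l = 1%N by lia.
  by apply: compute_ret; apply: known1_const.
have lt_kl : (uphalf l < l)%N by lia.
have kd : (0 < uphalf l <= d)%N by lia.
apply: (@compute_le _ _ _ _
  (16 * (d * q * (uphalf l).-1) + 4 * mulcost l) _ (known l h)) => //.
  apply: compute_bind (IH _ lt_kl kd) _ => t st hk.
  apply: (compute_inv_step ld _ _ (known_le _ (known_ext st hv)) hk); try lia.
  by move=> x; apply: small_le (vh x); lia.
rewrite /mulcost; set Q := (d * q)%N.
have -> : (l * d * q = Q * l)%N by rewrite /Q; lia.
have : (Q * (4 * (uphalf l).-1 + l) <= Q * (4 * l.-1))%N by rewrite leq_mul; lia.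
by lia.
Qed.

(** G and its inverse H are refined together: the step on G uses H at the old order only, and the
    new G then serves to refine H. A round costs 7 + 4 = 11 products, and 44 = 4 * 11 by the
    recurrence of [compute_inv]. *)
Lemma compute_ode W G H s :
  (forall x, small d d (G x * H x - 1)) ->
  (forall x, small d d (euler (G x) - W x * G x)) ->
  (forall x, small 1 d (G x - 1)) ->
  known_nats s -> known d W s -> compute s (44 * mulcost d) (known d G).
Proof.
move=> GH ode G1 hN hW.
have H1 x : small 1 d (H x - 1) by apply: small_inv1 (GH x) (G1 x).
suff: forall l, (0 < l <= d)%N ->
    compute s (44 * (d * q * l.-1)) (fun t => known l G t /\ known l H t).
  move=> /(_ d); rewrite d0 leqnn => /(_ isT) hd.
  by apply: compute_le hd _ _ => [|t _ []] //; rewrite /mulcost; nia.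
elim/ltn_ind=> l IH ld; have [l1|l1] := leqP l 1.
  have -> : l = 1%N by lia.
  by apply: compute_ret; split; apply: known1_const.
have lt_kl : (uphalf l < l)%N by lia.
have kd : (0 < uphalf l <= d)%N by lia.
apply: (@compute_le _ _ _ _
  (44 * (d * q * (uphalf l).-1) + (7 * mulcost l + 4 * mulcost l)) _
  (fun t => known l G t /\ known l H t)) => //.
  apply: compute_bind (IH _ lt_kl kd) _ => t st [hG hH].
  have GHl x : small l d (G x * H x - 1) by apply: small_le (GH x); lia.
  apply: (compute_bind (Q := known l G)).
    apply: (@compute_ode_step (uphalf l) l W G H) => //; try lia.
    - by move=> x; apply: small_le (ode x); lia.
    - exact: known_nats_ext st hN.
    - by apply: known_le (known_ext st hW); lia.
  move=> u tu hGl.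
  have hHu := known_ext tu hH.
  apply: compute_le (compute_inv_step ld _ GHl hGl hHu) (leqnn _) _; first lia.
  by move=> w uw hw; split=> //; apply: known_ext uw hGl.
rewrite /mulcost; set Q := (d * q)%N.
have -> : (l * d * q = Q * l)%N by rewrite /Q; lia.
have : (Q * (4 * (uphalf l).-1 + l) <= Q * (4 * l.-1))%N by rewrite leq_mul; lia.
by lia.
Qed.

End Newton.

(** * Product trees *)

Section ProductTree.
Local Open Scope ring_scope.
Variables (R : fieldType) (K : pred R) (X : Type) (C0 d q : nat).
Hypothesis fastK : fast_multiplication K C0.
Hypothesis d1 : (1 < d)%N.
Hypothesis q0 : (0 < q)%N.
Hypothesis costM1 : forall n, (1 < n <= d.+1)%N ->
  (C0 * (n * trunc_log 2 n) <= n * q)%N.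
Local Notation F := (X -> R).
Local Notation avail := (avail K).
Local Notation compute := (compute K).
Local Notation known1 := (known1 K).
Implicit Types (s t : seq F) (l : seq F).

Definition prod_linear l (x : X) : {poly R} := \prod_(b <- l) (1 - b x *: 'X).

Lemma size_prod_linear l x : (size (prod_linear l x) <= (size l).+1)%N.
Proof.
rewrite /prod_linear; elim: l => [|b l IH]; first by rewrite big_nil size_poly1.
rewrite big_cons; apply: leq_trans (size_polyMleq _ _) _.
have h : (size (1 - b x *: 'X)%R <= 2)%N.
  rewrite (leq_trans (size_polyD _ _)) // size_poly1 size_polyN geq_max /=.
  by rewrite (leq_trans (size_scale_leq _ _)) // size_polyX.
by move: (leq_add h IH); case: (_ + _)%N.
Qed.

Lemma known_all_prod_linear l s : known1 (size l).+1 (prod_linear l) s ->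
  forall n, known1 n (prod_linear l) s.
Proof.
move=> h n i lt_in; have [lt_il|le_li] := ltnP i (size l).+1; first exact: h.
apply: avail_eq (avail0 _ _) => x; rewrite nth_default //.
exact: leq_trans (size_prod_linear _ _) _.
Qed.

(** A leaf 1 - b s costs one subtraction. A node with n >= 2 factors has n + 1 coefficients and
    costs at most (n + 1) q <= 2 n q, hence at most 2 q (size l) for each of the k levels. *)
Lemma compute_prod_linear_small k l s : (size l <= d)%N -> (size l <= 2 ^ k)%N ->
  (forall i, avail s (nth (fun=> 0) l i)) ->
  compute s (size l * (1 + 2 * q * k))
    (fun t => forall n, known1 n (prod_linear l) t).
Proof.
elim: k l s => [|k IH] l s ld lk hl.
  case: l ld lk hl => [|b [|//]] _ _ hl.
    apply: compute_ret => n i _; have [->|i0] := eqVneq i 0%N.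
      by apply: avail_eq (avail1 _ _) => x; rewrite /prod_linear big_nil coef1.
    by apply: avail_eq (avail0 _ _) => x;
      rewrite /prod_linear big_nil coef1 (negPf i0).
  apply: compute_le (compute_sub (avail0 _ _) (hl 0%N)) _ _ => //.
  move=> t st hb n [|[|i]] _.
  - apply: avail_eq (avail1 _ _) => x.
    by rewrite /prod_linear big_seq1 coefB coef1 coefZ coefX mulr0 subr0.
  - apply: avail_eq hb => x.
    by rewrite /prod_linear big_seq1 coefB coef1 coefZ coefX mulr1.
  - apply: avail_eq (avail0 _ _) => x.
    by rewrite /prod_linear big_seq1 coefB coef1 coefZ coefX mulr0 subr0.
have [l1|l1] := leqP (size l) 1.
  apply: compute_le (IH l s ld _ hl) _ _ => //; last by nia.
  by apply: leq_trans l1 _; rewrite expn_gt0.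
pose l' := take (size l)./2 l; pose l'' := drop (size l)./2 l.
have sl' : size l' = (size l)./2 by rewrite size_takel //; lia.
have sl'' : size l'' = uphalf (size l) by rewrite size_drop; lia.
move: lk; rewrite expnS => lk.
apply: (@compute_le _ _ _ _ (size l' * (1 + 2 * q * k) +
  (size l'' * (1 + 2 * q * k) + (size l).+1 * q)) _
  (known1 (size l).+1 (prod_linear l))).
- apply: compute_bind (IH l' s _ _ _) _; try lia.
    move=> i; have [lt_i|le_i] := ltnP i (size l)./2.
      by rewrite nth_take //; apply: hl.
    by rewrite nth_default ?sl' //; apply: avail0.
  move=> t st h'; apply: compute_bind (IH l'' t _ _ _) _; try lia.
    by move=> i; rewrite nth_drop; apply: avail_ext st _.
  move=> u tu h''.
  have hmul := compute_mul1 fastK (n := (size l).+1) _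
    (known1_ext tu (h' _)) (h'' _).
  apply: compute_le (hmul _) _ _; try lia.
    by apply: costM1; lia.
  move=> w _ hw i lt_i; apply: avail_eq (hw i lt_i) => x.
  by rewrite /prod_linear -big_cat cat_take_drop.
- rewrite sl' sl'' addnA -mulnDl (_ : ((size l)./2 + uphalf (size l) = size l)%N); last by lia.
  have : ((size l).+1 * q <= 2 * size l * q)%N by rewrite leq_mul //; lia.
  by rewrite mulnSr; lia.
by move=> t _; apply: known_all_prod_linear.
Qed.

(* Only blocks of d factors are multiplied by a balanced tree, so that the *)
(* depth is log d rather than log (size l).                                *)
Lemma compute_prod_linear k l s : (d <= 2 ^ k)%N ->
  (forall i, avail s (nth (fun=> 0) l i)) ->
  compute s (size l * (1 + 2 * q * k + q)) (known1 d (prod_linear l)).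
Proof.
move=> dk; move: {2}(size l) (leqnn (size l)) => m.
elim: m l s => [|m IH] l s lm hl.
  apply: compute_le (compute_prod_linear_small (k := k) (l := l) _ _ hl) _ _;
    try nia.
  by move=> t _; apply.
have [ld|ld] := leqP (size l) d.
  apply: compute_le (compute_prod_linear_small (k := k) (l := l) _ _ hl) _ _;
    try nia.
  by move=> t _; apply.
have s1 : size (take d l) = d by rewrite size_take ld.
have s2 : size (drop d l) = (size l - d)%N by rewrite size_drop.
apply: (@compute_le _ _ _ _ (d * (1 + 2 * q * k) +
  ((size l - d) * (1 + 2 * q * k + q) + d * q)) _
  (known1 d (prod_linear l))) => //; last by nia.
rewrite -{1}s1 -s2.
apply: compute_bind (compute_prod_linear_small (k := k) _ _ _) _; try by rewrite s1.
  move=> i; have [lt_i|le_i] := ltnP i d.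
    by rewrite nth_take //; apply: hl.
  by rewrite nth_default ?s1 //; apply: avail0.
move=> t st h'; apply: compute_bind (IH (drop d l) t _ _) _; first by lia.
  by move=> i; rewrite nth_drop; apply: avail_ext st _.
move=> u tu h''.
apply: compute_le (compute_mul1 fastK d1 (known1_ext tu (h' _)) h'') _ _.
  by apply: costM1; lia.
move=> w _ hw i lt_i; apply: avail_eq (hw i lt_i) => x.
by rewrite /prod_linear -big_cat cat_take_drop.
Qed.

End ProductTree.

(** * Logarithmic derivatives of power series *)

Section PowerSeriesMorphism.
Local Open Scope ring_scope.
Variables (A A' : comNzRingType) (phi : {rmorphism A -> A'}).
Implicit Types (u v : nat -> A) (f g : nat -> A').

(** The operations on series are ring expressions in the coefficients, hence preserved by phi. This
    transports identities from R[y] to R[y_1, ..., y_r]. *)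
Definition ps_image u f := forall n, phi (u n) = f n.

Lemma ps_image_one : ps_image (ps_one A) (ps_one A').
Proof. by move=> n; rewrite /ps_one rmorph_nat. Qed.

Lemma ps_image_sub u v f g : ps_image u f -> ps_image v g ->
  ps_image (ps_sub u v) (ps_sub f g).
Proof. by move=> hu hv n; rewrite /ps_sub rmorphB hu hv. Qed.

Lemma ps_image_mul u v f g : ps_image u f -> ps_image v g ->
  ps_image (ps_mul u v) (ps_mul f g).
Proof.
move=> hu hv n; rewrite /ps_mul rmorph_sum; apply: eq_bigr => i _.
by rewrite rmorphM hu hv.
Qed.

Lemma ps_image_inv u f : ps_image u f -> ps_image (ps_inv u) (ps_inv f).
Proof.
move=> hu n; rewrite /ps_inv rmorph_sum; apply: eq_bigr => k _.
elim: (nat_of_ord k) {2 4}n => [|m IH] j; first exact: ps_image_one.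
by apply: ps_image_mul IH _; apply: ps_image_sub hu; apply: ps_image_one.
Qed.

Lemma ps_image_div u v f g : ps_image u f -> ps_image v g ->
  ps_image (ps_div u v) (ps_div f g).
Proof. by move=> hu hv; apply: ps_image_mul hu (ps_image_inv hv). Qed.

Lemma ps_image_dilate c c' u f : phi c = c' -> ps_image u f ->
  ps_image (ps_dilate c u) (ps_dilate c' f).
Proof. by move=> hc hu n; rewrite /ps_dilate rmorphM rmorphXn hc hu. Qed.

Lemma ps_image_prod (I : Type) (l : seq I) (u : I -> nat -> A)
    (f : I -> nat -> A') : (forall i, ps_image (u i) (f i)) ->
  ps_image (\big[@ps_mul A/ps_one A]_(i <- l) u i)
           (\big[@ps_mul A'/ps_one A']_(i <- l) f i).
Proof.
move=> h; elim: l => [|i l IH]; first by rewrite !big_nil; apply: ps_image_one.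
by rewrite !big_cons; apply: ps_image_mul.
Qed.

End PowerSeriesMorphism.

(** * Truncated power series as polynomials *)

Section Truncation.
Local Open Scope ring_scope.
Variables (A : comNzRingType) (d : nat).
Implicit Types (u v : nat -> A).

Definition ps_poly u : {poly A} := \poly_(i < d) u i.

Lemma coef_ps_poly u n : (n < d)%N -> (ps_poly u)`_n = u n.
Proof. by move=> h; rewrite coef_poly h. Qed.

Lemma coef_ps_polyM u v n : (n < d)%N ->
  (ps_poly u * ps_poly v)`_n = ps_mul u v n.
Proof.
move=> lt_nd; rewrite coefM; apply: eq_bigr => i _.
by have := ltn_ord i => lt_in; rewrite !coef_ps_poly //; lia.
Qed.

Lemma coef_dilate c (p : {poly A}) n : (p \Po (c *: 'X))`_n = c ^+ n * p`_n.
Proof.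
rewrite coef_comp_poly; under eq_bigr => i _ do rewrite exprZn coefZ coefXn.
have [lt_n|le_n] := ltnP n (size p).
  rewrite (bigD1 (Ordinal lt_n)) //= eqxx mulr1 mulrC big1 ?addr0 // => i ne_in.
  by rewrite eq_sym [_ == _](negPf ne_in) !mulr0.
rewrite big1 ?nth_default ?mulr0 // => i _.
by rewrite gtn_eqF ?mulr0 // (leq_trans (ltn_ord i)).
Qed.

Lemma ps_poly_dilate c u : ps_poly (ps_dilate c u) = ps_poly u \Po (c *: 'X).
Proof.
apply/polyP => n; rewrite coef_dilate !coef_poly /ps_dilate.
by case: ifP; rewrite ?mulr0.
Qed.

Lemma euler_dilate c (p : {poly A}) :
  euler (p \Po (c *: 'X)) = euler p \Po (c *: 'X).
Proof.
by apply/polyP => n; rewrite !(coef_euler, coef_dilate) mulrnAr.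
Qed.

Lemma ps_mul_0 u v : ps_mul u v 0%N = u 0%N * v 0%N.
Proof. by rewrite /ps_mul big_ord1. Qed.

Lemma ps_inv_0 u : ps_inv u 0%N = 1.
Proof. by rewrite /ps_inv big_ord1. Qed.

Lemma ps_dilate_0 c u : ps_dilate c u 0%N = u 0%N.
Proof. by rewrite /ps_dilate expr0 mul1r. Qed.

Lemma ps_prod_0 (I : Type) (l : seq I) (u : I -> nat -> A) :
  (forall i, u i 0%N = 1) -> (\big[@ps_mul A/ps_one A]_(i <- l) u i) 0%N = 1.
Proof.
move=> h; elim: l => [|i l IH]; first by rewrite big_nil.
by rewrite big_cons ps_mul_0 h IH mulr1.
Qed.

(* v is the inverse of the series f of the informal statement. *)
Definition ps_prods u (l : seq A) : nat -> A :=
  \big[@ps_mul A/ps_one A]_(b <- l) ps_dilate b u.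

Definition ps_factor c (E v : nat -> A) (l l' : seq A) : nat -> A :=
  ps_mul (ps_dilate c E) (ps_div (ps_prods (ps_inv v) l) (ps_prods (ps_inv v) l')).

Lemma ps_prods_0 u l : u 0%N = 1 -> ps_prods u l 0%N = 1.
Proof. by move=> h; apply: ps_prod_0 => b; rewrite ps_dilate_0. Qed.

Lemma ps_factor_0 c E v l l' : E 0%N = 1 -> ps_factor c E v l l' 0%N = 1.
Proof.
move=> hE; rewrite /ps_factor /ps_div !ps_mul_0 ps_dilate_0 hE ps_inv_0.
by rewrite ps_prods_0 ?ps_inv_0 // !mulr1.
Qed.

End Truncation.

(** * Calculus of logarithmic derivatives modulo (s^d, y^e) *)

Section LogDerivative.
Local Open Scope ring_scope.
Variables (R : comNzRingType) (d e : nat).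
Local Notation bipoly := {poly {poly R}}.
Local Notation P := (@ps_poly {poly R} d).
Implicit Types (u v : nat -> {poly R}) (p w : bipoly).

(* p'/p = w/s modulo (s^d, y^e). *)
Definition logder p w := small d e (euler p - w * p).

Lemma small_eqs p p' : (forall n, (n < d)%N -> p`_n = p'`_n) -> small d e (p - p').
Proof. by move=> h i j lt_id _; rewrite coefB h // subrr coef0. Qed.

Lemma logder_cong p p' w : small d e (p - p') -> logder p w -> logder p' w.
Proof.
move=> h hw; rewrite /logder.
have -> : euler p' - w * p' =
    (euler p - w * p) - (euler (p - p') - w * (p - p')) by rewrite eulerB; ring.
by apply: smallB => //; apply: smallB; [apply: small_euler|apply: smallMl].
Qed.

Lemma logderM p q w w' : logder p w -> logder q w' -> logder (p * q) (w + w').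
Proof.
move=> hp hq; rewrite /logder.
have -> : euler (p * q) - (w + w') * (p * q) =
  (euler p - w * p) * q + p * (euler q - w' * q) by rewrite eulerM; ring.
by apply: smallD; [apply: smallMr|apply: smallMl].
Qed.

Lemma logderV p q w : small d e (p * q - 1) -> logder p w -> logder q (- w).
Proof.
move=> hpq hp; rewrite /logder.
have -> : euler q - - w * q = (q * euler (p * q - 1) - q ^+ 2 * (euler p - w * p))
     - (p * q - 1) * (w * q + euler q).
  by rewrite eulerB euler1 eulerM; ring.
apply: smallB; last exact: smallMr.
by apply: smallB; apply: smallMl => //; apply: small_euler.
Qed.

Lemma logder1 : logder 1 0.
Proof. by rewrite /logder euler1 mul0r subrr => i j _ _; rewrite !coef0. Qed.

(** As p is invertible, w can only be (theta p) / p. This identifies a computed logarithmic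
    derivative with its expression by power sums. *)
Lemma logder_unique p q w w' : small d e (p * q - 1) ->
  logder p w -> logder p w' -> small d e (w - w').
Proof.
move=> hpq hw hw'.
have -> : w - w' = q * ((euler p - w' * p) - (euler p - w * p))
   - (w - w') * (p * q - 1) by ring.
by apply: smallB; apply: smallMl => //; apply: smallB.
Qed.

Lemma small_dilate c p : small d e p -> small d e (p \Po (c *: 'X)).
Proof.
move=> h i j lt_id lt_je; rewrite coef_dilate coefM big1 // => k _.
by rewrite h ?mulr0 //; have := ltn_ord k; lia.
Qed.

Lemma logder_dilate c p w : logder p w ->
  logder (p \Po (c *: 'X)) (w \Po (c *: 'X)).
Proof.
by move=> h; rewrite /logder euler_dilate -comp_polyM -comp_polyB; apply: small_dilate.
Qed.

Lemma logder_psM u v w w' : logder (P u) w -> logder (P v) w' ->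
  logder (P (ps_mul u v)) (w + w').
Proof.
move=> hu hv; apply: logder_cong (logderM hu hv); apply: small_eqs => n lt_nd.
by rewrite coef_ps_polyM ?coef_ps_poly.
Qed.

Lemma small_ps_inv u : u 0%N = 1 -> small d e (P u * P (ps_inv u) - 1).
Proof.
move=> u0; apply: small_eqs => n lt_nd.
by rewrite coef_ps_polyM // ps_mulV // coef1.
Qed.

Lemma logder_ps_inv u w : u 0%N = 1 -> logder (P u) w ->
  logder (P (ps_inv u)) (- w).
Proof. by move=> u0; apply: logderV; apply: small_ps_inv. Qed.

Lemma logder_euler u : u 0%N = 1 ->
  logder (P u) (euler (P u) * P (ps_inv u)).
Proof.
move=> u0; rewrite /logder; have -> : euler (P u) - euler (P u) * P (ps_inv u) * P u
  = - (euler (P u) * (P u * P (ps_inv u) - 1)) by ring.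
by apply: smallN; apply: smallMl; apply: small_ps_inv.
Qed.

(** Dilation by b multiplies w_n by b^n, so the n-th coefficient of the sum is w_n times the n-th
    power sum of l. *)
Lemma logder_ps_prods u w l : logder (P u) w ->
  logder (P (ps_prods u l)) (\sum_(b <- l) (w \Po (b *: 'X))).
Proof.
move=> hw; rewrite /ps_prods; elim: l => [|b l IH].
  rewrite !big_nil; apply: logder_cong logder1; apply: small_eqs => n lt_nd.
  by rewrite coef_ps_poly // coef1.
rewrite !big_cons; apply: logder_psM => //; rewrite ps_poly_dilate.
exact: logder_dilate.
Qed.

Lemma logder_ps_factor c (E v : nat -> {poly R}) l l' : v 0%N = 1 ->
  logder (P E) 'X ->
  let w := - (euler (P v) * P (ps_inv v)) in
  logder (P (ps_factor c E v l l'))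
    (c *: 'X + (\sum_(b <- l) (w \Po (b *: 'X)) - \sum_(b <- l') (w \Po (b *: 'X)))).
Proof.
move=> v0 hE w; have hw : logder (P (ps_inv v)) w.
  by apply: logder_ps_inv => //; apply: logder_euler.
apply: logder_psM.
  by rewrite ps_poly_dilate -[c *: 'X as X in logder _ X]comp_polyX; apply: logder_dilate.
apply: logder_psM; first exact: logder_ps_prods.
by apply: logder_ps_inv; [rewrite ps_prods_0 ?ps_inv_0|apply: logder_ps_prods].
Qed.

(* (1 - b s) \sum_i (b s)^i = 1 modulo s^d, so 1 - b s has logarithmic *)
(* derivative -\sum_(0 < i < d) (b s)^i: the power sums of the b's are *)
(* read off the logarithmic derivative of \prod_b (1 - b s).           *)
Lemma logder_prod_linear (l : seq {poly R}) :
  logder (\prod_(b <- l) (1 - b *: 'X))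
    (\sum_(b <- l) (1 - P (fun n => b ^+ n))).
Proof.
elim: l => [|b l IH]; first by rewrite !big_nil; apply: logder1.
rewrite !big_cons; apply: logderM => //; rewrite /logder.
have -> : euler (1 - b *: 'X) = - (b *: 'X) :> bipoly.
  by rewrite eulerB euler1 sub0r /euler derivZ derivX -!mul_polyC; ring.
set g := P _; rewrite -(opprK (_ - _)); apply: smallN.
have -> : - (- (b *: 'X) - (1 - g) * (1 - b *: 'X)) = 1 - g * (1 - b *: 'X).
  by ring.
rewrite -opprB; apply: smallN; apply: small_eqs => n lt_nd.
rewrite mulrBr mulr1 -scalerAr coefB coefZ coefMX coef1 !coef_poly.
rewrite lt_nd; case: n lt_nd => [|n] lt_nd /=; first by rewrite mulr0 subr0.
by rewrite ltnW // exprS subrr.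
Qed.

End LogDerivative.

(** * Cost of one factor *)

Section Factor.
Local Open Scope ring_scope.
Variables (R : fieldType) (K : pred R) (X : Type) (C0 d q k : nat).
Hypothesis fastK : fast_multiplication K C0.
Hypothesis d1 : (1 < d)%N.
Hypothesis q0 : (0 < q)%N.
Hypothesis costM : forall n, (0 < n <= d)%N ->
  (C0 * (2 * d * n * trunc_log 2 (2 * d * n)) <= n * d * q)%N.
Hypothesis costM1 : forall n, (1 < n <= d.+1)%N ->
  (C0 * (n * trunc_log 2 n) <= n * q)%N.
Hypothesis dk : (d <= 2 ^ k)%N.
Hypothesis natR : forall n, (0 < n <= d)%N -> n%:R != 0 :> R.
Local Notation F := (X -> R).
Local Notation bipoly := {poly {poly R}}.
Local Notation avail := (avail K).
Local Notation compute := (compute K).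
Local Notation known n u := (known K n d u).
Local Notation P := (@ps_poly {poly R} d).
Implicit Types (s t : seq F) (l : seq F) (v : nat -> {poly R}).

Let d0 : (0 < d)%N. Proof. exact: ltnW. Qed.

Definition const_series (p : {poly R}) : bipoly := map_poly polyC p.

Lemma known_const_series f s : known1 K d f s ->
  known d (fun x => const_series (f x)) s.
Proof.
move=> hf i [|j] lt_id lt_jd.
  by apply: avail_eq (hf i lt_id) => x; rewrite coef_map coefC.
by apply: avail_eq (avail0 _ _) => x; rewrite coef_map coefC.
Qed.

Definition lift_values l x : seq {poly R} := [seq (b x)%:P | b : F <- l].

Lemma const_series_prod_linear l x :
  const_series (prod_linear l x) = \prod_(b <- lift_values l x) (1 - b *: 'X).
Proof.
rewrite /const_series /prod_linear rmorph_prod big_map; apply: eq_bigr => b _.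
by rewrite rmorphB /= rmorph1 map_polyZ map_polyX.
Qed.

Definition linear_logder l x : bipoly :=
  let D := const_series (prod_linear l x) in
  euler D * P (ps_inv (fun n => D`_n)).

Lemma prod_linear_0 l x : (const_series (prod_linear l x))`_0 = 1.
Proof.
rewrite coef_map /prod_linear coef0_prod big1 ?polyC1 //.
by move=> b _; rewrite coefB coef1 coefZ coefX mulr0 subr0.
Qed.

Lemma small_prod_linear_inv l x :
  let D := const_series (prod_linear l x) in
  small d d (D * P (ps_inv (fun n => D`_n)) - 1).
Proof.
move=> D; have D0 : D`_0 = 1 by apply: prod_linear_0.
have DP : small d d (P (fun n => D`_n) - D).
  by apply: small_eqs => n lt_nd; rewrite coef_ps_poly.
rewrite -{1}(subKr (P (fun n => D`_n)) D) mulrBl addrAC.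
apply: smallB; last exact: smallMr.
exact: (@small_ps_inv _ d d (fun n => D`_n)).
Qed.

(** Both (theta D) / D and the sum of the series of [logder_prod_linear] are logarithmic derivatives
    of D, hence agree. *)
Lemma linear_logder_coef l x n j : (0 < n < d)%N -> (j < d)%N ->
  (linear_logder l x)`_n`_j = - (\sum_(b <- lift_values l x) b ^+ n)`_j.
Proof.
move=> /andP [n0 lt_nd] lt_jd.
set D := const_series (prod_linear l x).
have hD := @small_prod_linear_inv l x; rewrite -/D in hD.
have h1 : logder d d D (linear_logder l x).
  rewrite /logder /linear_logder -/D.
  set Y := P _; have -> : euler D - euler D * Y * D = - (euler D * (D * Y - 1)).
    by ring.
  by apply: smallN; apply: smallMl.
have h2 := @logder_prod_linear R d d (lift_values l x).
rewrite -const_series_prod_linear in h2.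
rewrite (small_coefE (logder_unique hD h1 h2) lt_nd lt_jd).
rewrite !coef_sum -sumrN; apply: eq_bigr => b _.
by rewrite coefB coef_ps_poly // coef1 eqn0Ngt n0 sub0r coefN.
Qed.

Lemma compute_linear_logder l s :
  (forall i, avail s (nth (fun=> 0) l i)) -> known_nats K d s ->
  compute s (size l * (1 + 2 * q * k + q) + 18 * mulcost d q d)
    (known d (linear_logder l)).
Proof.
move=> hl hN; have dd : (0 < d <= d)%N by rewrite d0 leqnn.
apply: compute_bind (compute_prod_linear fastK d1 q0 costM1 dk hl) _.
move=> t st /known_const_series hD.
have -> : (18 * mulcost d q d = 16 * mulcost d q d + (mulcost d q d + mulcost d q d))%N by lia.
pose Dinv x := P (ps_inv (fun n => (const_series (prod_linear l x))`_n)).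
apply: compute_bind
  (compute_inv fastK d0 q0 costM (h := Dinv) _ _ hD) _.
- by move=> x; apply: small_prod_linear_inv.
- move=> x [|//] j _ lt_jd; rewrite coefB prod_linear_0.
  by rewrite coef1 eqxx subrr coef0.
move=> u tu hI; have hD' := known_ext tu hD.
have hN' := known_nats_ext (extends_trans st tu) hN.
apply: compute_bind (compute_bi_euler d0 q0 (leqnn d) hN' hD') _ => w uw hE.
exact: (compute_bi_mul fastK d0 costM dd hE (known_ext uw hI)).
Qed.

Definition exp_series : nat -> {poly R} := fun n => (n`!%:R^-1)%:P.

Lemma logder_exp_series : logder d d (P exp_series) 'X.
Proof.
apply: small_eqs => n lt_nd; rewrite coef_euler coefXM !coef_poly lt_nd.
case: n lt_nd => [|n] lt_nd /=; first by rewrite mulr0n.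
rewrite ltnW // /exp_series -raddfMn /= -[_ *+ n.+1]mulr_natr factS natrM invfM.
by rewrite mulrAC mulVf ?mul1r //; apply: natR; lia.
Qed.

Definition factor v (alpha : F) l l' x : nat -> {poly R} :=
  ps_factor (alpha x)%:P exp_series v (lift_values l x) (lift_values l' x).

Lemma exp_series_0 : exp_series 0%N = 1.
Proof. by rewrite /exp_series fact0 invr1. Qed.

Lemma sum_dilate_coef (w : bipoly) l x i :
  (\sum_(b <- lift_values l x) (w \Po (b *: 'X)))`_i =
  (\sum_(b <- lift_values l x) b ^+ i) * w`_i.
Proof.
rewrite coef_sum mulr_suml; apply: eq_bigr => b _; exact: coef_dilate.
Qed.

Lemma sum_lift_values l x i : \sum_(b <- lift_values l x) b ^+ i =
  (\sum_(b <- l) b x ^+ i)%:P.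
Proof.
by rewrite big_map raddf_sum; apply: eq_bigr => b _; rewrite /= polyC_exp.
Qed.

Lemma compute_factor v alpha l l' s : v 0%N = 1 ->
  known d (fun=> P v) s -> avail s alpha ->
  (forall i, avail s (nth (fun=> 0) l i)) ->
  (forall i, avail s (nth (fun=> 0) l' i)) -> known_nats K d s ->
  compute s ((size l + size l') * (1 + 2 * q * k + q) + 101 * mulcost d q d)
    (known d (fun x => P (factor v alpha l l' x))).
Proof.
move=> v0 hv hal hl hl' hN; have dd : (0 < d <= d)%N by rewrite d0 leqnn.
pose V : bipoly := euler (P v) * P (ps_inv v).
(* Here 101 = 18 + 18 + 16 + 1 + 1 + 3 + 44: power sums of both lists, inverse of v, theta v, their
   product V, three operations per coefficient of W, and the differential equation. *)
apply: (@compute_le _ _ _ _ ((size l * (1 + 2 * q * k + q) + 18 * mulcost d q d) +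
  ((size l' * (1 + 2 * q * k + q) + 18 * mulcost d q d) +
  (16 * mulcost d q d + (mulcost d q d + (mulcost d q d + (d * d * 3 + 44 * mulcost d q d))))))
  _ (known d (fun x => P (factor v alpha l l' x)))) => //; last first.
  have : (d * d * 3 <= 3 * mulcost d q d)%N by rewrite /mulcost; nia.
  by rewrite mulnDl; lia.
apply: compute_bind (compute_linear_logder hl hN) _ => t1 s1 h1.
have hN1 := known_nats_ext s1 hN.
have hl1 i := avail_ext s1 (hl' i).
apply: compute_bind (compute_linear_logder hl1 hN1) _ => t2 s2 h2.
have hN2 := known_nats_ext s2 hN1; have {h1} h12 := known_ext s2 h1.
have s02 := extends_trans s1 s2; have hv2 := known_ext s02 hv.
apply: compute_bind (compute_inv fastK d0 q0 costM (h := fun=> P (ps_inv v)) _ _ hv2) _.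
- by move=> x; apply: small_ps_inv.
- move=> x [|//] j _ lt_jd; rewrite coefB coef_ps_poly // v0.
  by rewrite coef1 eqxx subrr coef0.
move=> t3 s3 h3; have hN3 := known_nats_ext s3 hN2.
apply: compute_bind (compute_bi_euler d0 q0 (leqnn d) hN3 (known_ext s3 hv2)) _.
move=> t4 s4 h4.
apply: compute_bind (compute_bi_mul fastK d0 costM dd h4 (known_ext s4 h3)) _.
move=> t5 s5 h5; have s25 := extends_trans s3 (extends_trans s4 s5).
have hN5 := known_nats_ext s25 hN2.
have h15 := known_ext s25 h12; have h25 := known_ext s25 h2.
have hal5 := avail_ext (extends_trans s02 s25) hal.
pose w : bipoly := - V.
pose W x : bipoly := (alpha x)%:P *: 'X +
  (\sum_(b <- lift_values l x) (w \Po (b *: 'X)) -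
   \sum_(b <- lift_values l' x) (w \Po (b *: 'X))).
(* [linear_logder] yields minus the power sums, and V is minus the logarithmic derivative of 1 / v:
   the two signs cancel. The last summand is the term alpha s. *)
apply: compute_bind (compute_nat2 (n := d) (e := d) (M := 3)
  (f := fun i j x => ((linear_logder l x)`_i`_0 - (linear_logder l' x)`_i`_0)
     * V`_i`_j + (if (i == 1%N) && (j == 0%N) then alpha x else 0)) _) _.
  move=> i j t lt_id lt_jd st.
  have c1 := compute_sub (avail_ext st (h15 i 0%N lt_id d0))
    (avail_ext st (h25 i 0%N lt_id d0)).
  apply: (compute_bind (N := 2) c1) => u tu hu.
  have c2 := compute_mul hu (avail_ext (extends_trans st tu) (h5 i j lt_id lt_jd)).
  apply: (compute_bind (N := 1) c2) => z uz hz.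
  apply: (compute_add
    (g := fun x => if (i == 1%N) && (j == 0%N) then alpha x else 0)) hz _.
  case: ((i == 1%N) && (j == 0%N)); last exact: avail0.
  exact: avail_ext (extends_trans st (extends_trans tu uz)) hal5.
move=> t6 s6 h6.
have hW : known d W t6.
  move=> i j lt_id lt_jd; apply: avail_eq (h6 i j lt_id lt_jd) => x.
  rewrite /W coefD coefB !sum_dilate_coef -mulrBl coefZ coefX coefD addrC.
  congr (_ + _).
    by case: (i == 1%N); rewrite ?mulr1 ?mulr0 ?coefC ?coef0 //=; case: eqP.
  (* At order 0 [linear_logder] does not give the power sum, which is the length of the list; both
     sides vanish because V_0 = 0. *)
  have [i0|i0] := posnP i.
    have V0 : V`_0 = 0.
      by rewrite /V coefM big_ord1 coef_euler mulr0n mul0r.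
    by rewrite i0 /w coefN V0 oppr0 mulr0 !coef0 mulr0.
  have hi : (0 < i < d)%N by rewrite i0.
  rewrite !linear_logder_coef // /w !sum_lift_values -polyCB coefCM !coefC /=.
  by rewrite !coefN; ring.
apply: (@compute_ode _ _ _ _ _ _ fastK d0 q0 costM natR W _
  (fun x => P (ps_inv (factor v alpha l l' x)))) => //.
- by move=> x; apply: small_ps_inv; rewrite /factor ps_factor_0 ?exp_series_0.
- by move=> x; apply: logder_ps_factor v0 logder_exp_series.
- move=> x [|//] j _ lt_jd; rewrite coefB coef_ps_poly // /factor.
  by rewrite ps_factor_0 ?exp_series_0 // coef1 eqxx subrr coef0.
exact: known_nats_ext s6 hN5.
Qed.

End Factor.

(** * Coefficients of the generalized Todd polynomials *)

Section Graded.
Local Open Scope ring_scope.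
Variable R : fieldType.
Implicit Types u v : nat -> {poly R}.

(** Holds for the factors because y always comes with e^s - 1, a multiple of s. Hence computing
    modulo y^d loses nothing in the coefficients of s^n for n < d. *)
Definition graded u := forall n, (size (u n) <= n.+1)%N.

Lemma graded_one : graded (ps_one {poly R}).
Proof.
move=> n; rewrite /ps_one; case: (n == 0%N); first by rewrite size_poly1.
by rewrite size_poly0.
Qed.

Lemma graded_sub u v : graded u -> graded v -> graded (ps_sub u v).
Proof.
move=> hu hv n; rewrite /ps_sub (leq_trans (size_polyD _ _)) //.
by rewrite size_polyN geq_max hu hv.
Qed.

Lemma graded_mul u v : graded u -> graded v -> graded (ps_mul u v).
Proof.
move=> hu hv n; rewrite /ps_mul.
apply: (big_ind (fun p : {poly R} => (size p <= n.+1)%N)).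
- by rewrite size_poly0.
- by move=> p q hp hq; rewrite (leq_trans (size_polyD _ _)) // geq_max hp.
move=> i _; apply: leq_trans (size_polyMleq _ _) _.
have := leq_add (hu i) (hv (n - i)%N).
have -> : (i.+1 + (n - i).+1 = n.+2)%N by have := ltn_ord i; lia.
by case: (_ + _)%N.
Qed.

Lemma graded_inv u : graded u -> graded (ps_inv u).
Proof.
move=> hu n; rewrite /ps_inv.
apply: (big_ind (fun p : {poly R} => (size p <= n.+1)%N)).
- by rewrite size_poly0.
- by move=> p q hp hq; rewrite (leq_trans (size_polyD _ _)) // geq_max hp.
move=> i _; suff: forall k, graded (ps_pow (ps_sub (ps_one {poly R}) u) k) by move=> h; apply: h.
elim=> [|k IH]; first exact: graded_one.
by apply: graded_mul IH; apply: graded_sub hu; apply: graded_one.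
Qed.

Lemma graded_dilate c u : graded u -> graded (ps_dilate c%:P u).
Proof.
move=> hu n; rewrite /ps_dilate -polyC_exp mul_polyC.
exact: leq_trans (size_scale_leq _ _) _.
Qed.

Lemma graded_prods u (l : seq R) : graded u ->
  graded (ps_prods u [seq b%:P | b <- l]).
Proof.
move=> hu; rewrite /ps_prods; elim: l => [|b l IH].
  by rewrite big_nil; apply: graded_one.
by rewrite big_cons; apply: graded_mul IH; apply: graded_dilate.
Qed.

Lemma graded_exp_series : graded (exp_series R).
Proof. by move=> n; rewrite (leq_trans (size_polyC_leq1 _)). Qed.

Lemma graded_factor c v (l l' : seq R) : graded v ->
  graded (ps_factor c%:P (exp_series R) v [seq b%:P | b <- l] [seq b%:P | b <- l']).
Proof.
move=> hv; apply: graded_mul.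
  by apply: graded_dilate; apply: graded_exp_series.
by apply: graded_mul; [|apply: graded_inv]; apply: graded_prods; apply: graded_inv.
Qed.

Definition todd_denom : nat -> {poly R} := fun n => exp_series R n.+1.

Definition todd_y_denom : nat -> {poly R} :=
  ps_sub (ps_one {poly R})
    (fun n => 'X * ps_sub (exp_series R) (ps_one {poly R}) n).

Lemma todd_denom_0 : todd_denom 0%N = 1.
Proof. by rewrite /todd_denom /exp_series factS fact0 muln1 invr1. Qed.

Lemma todd_y_denom_0 : todd_y_denom 0%N = 1.
Proof.
by rewrite /todd_y_denom /ps_sub /exp_series fact0 invr1 subrr mulr0 subr0.
Qed.

Lemma graded_todd_denom : graded todd_denom.
Proof. by move=> n; rewrite (leq_trans (size_polyC_leq1 _)). Qed.

Lemma graded_todd_y_denom : graded todd_y_denom.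
Proof.
case=> [|n]; first by rewrite todd_y_denom_0 size_poly1.
rewrite /todd_y_denom /ps_sub /ps_one /= sub0r subr0 size_polyN.
rewrite /exp_series mulrC mul_polyC.
by rewrite (leq_trans (size_scale_leq _ _)) // size_polyX.
Qed.

End Graded.

Section Slices.
Local Open Scope ring_scope.
Variable R : fieldType.
Local Notation bipoly := {poly {poly R}}.

(* The coefficient of y^k, a polynomial in s. *)
Definition slice (k : nat) (g : bipoly) : {poly R} := map_poly (coefp k) g.

Lemma coef_slice k g n : (slice k g)`_n = g`_n`_k.
Proof. by rewrite coef_map. Qed.

Lemma coef_prod_low (I : Type) (l : seq I) (p : I -> {poly R}) (k : I -> nat) n :
  (forall i j, (j < k i)%N -> (p i)`_j = 0) -> (n < \sum_(i <- l) k i)%N ->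
  (\prod_(i <- l) p i)`_n = 0.
Proof.
move=> hp; elim: l n => [|i l IH] n; first by rewrite big_nil.
rewrite !big_cons => lt_n; rewrite coefM big1 // => a _.
have [lt_ak|le_ka] := ltnP a (k i); first by rewrite hp ?mul0r.
by rewrite IH ?mulr0 //; have := ltn_ord a; lia.
Qed.

Lemma coef_prod_ps_poly (A : comNzRingType) d (I : Type) (l : seq I)
    (u : I -> nat -> A) n : (n < d)%N ->
  (\prod_(i <- l) ps_poly d (u i))`_n =
  (\big[@ps_mul A/ps_one A]_(i <- l) u i) n.
Proof.
elim: l n => [|i l IH] n lt_nd; first by rewrite !big_nil coef1.
rewrite !big_cons coefM; apply: eq_bigr => j _.
by rewrite coef_ps_poly ?IH //; have := ltn_ord j; lia.
Qed.

End Slices.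

(** * From the bivariate factors to the coefficients of gtd_n *)

Section Todd.
Local Open Scope ring_scope.
Variables (R : fieldType) (r d : nat).
Local Notation A := {mpoly R[r]}.
Local Notation bipoly := {poly {poly R}}.
Local Notation P := (@ps_poly {poly R} d).

(** The substitution y := t, used with t = 'X_i for the factor of y_i and with t = 0 for the factor
    of index 0, which is free of y. *)
Definition subst_y (t : A) : {poly R} -> A :=
  horner_morph (fun x => mulrC t (mpolyC r x)).

HB.instance Definition _ t := GRing.RMorphism.on (subst_y t).

Lemma subst_yC t c : subst_y t c%:P = c%:MP.
Proof. exact: horner_morphC. Qed.

Lemma subst_yX t : subst_y t 'X = t.
Proof. exact: horner_morphX. Qed.

Lemma subst_yE t (p : {poly R}) : (size p <= d)%N ->
  subst_y t p = \sum_(k < d) t ^+ k * (p`_k)%:MP.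
Proof.
move=> szp; rewrite /subst_y /horner_morph.
rewrite (@horner_coef_wide _ d) ?(leq_trans (size_poly _ _)) //.
by apply: eq_bigr => k _; rewrite coef_map mulrC.
Qed.

Lemma subst_y0 (p : {poly R}) : subst_y 0 p = (p`_0)%:MP.
Proof. by rewrite /subst_y /horner_morph horner_coef0 coef_map. Qed.

Definition denom (i : 'I_r.+1) : nat -> {poly R} :=
  if i == ord0 then todd_denom R else todd_y_denom R.

Variables (a : rat) (B B' : 'I_r.+1 -> seq int).

(* e^(as) is a factor of the series of index 0 only. *)
Definition weight (i : 'I_r.+1) : R := if i == ord0 then ratr a else 0.

Definition gtd_factor (i : 'I_r.+1) : nat -> {poly R} :=
  ps_factor (weight i)%:P (exp_series R) (denom i)
    [seq c%:P | c <- [seq b%:~R | b <- B i]]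
    [seq c%:P | c <- [seq b%:~R | b <- B' i]].

Lemma graded_gtd_factor i : graded (gtd_factor i).
Proof.
apply: graded_factor; rewrite /denom; case: ifP => _.
  exact: graded_todd_denom.
exact: graded_todd_y_denom.
Qed.

Lemma image_exp_series t : ps_image (subst_y t) (exp_series R) (ps_exp R r).
Proof. by move=> n; apply: subst_yC. Qed.

Lemma image_prods t u f (b : seq int) : ps_image (subst_y t) u f ->
  ps_image (subst_y t) (ps_prods u [seq c%:P | c <- [seq x%:~R | x <- b]])
    (ps_prod_dilate f b).
Proof.
move=> hu; rewrite /ps_prods !big_map; apply: ps_image_prod => c.
by apply: ps_image_dilate hu; rewrite /= subst_yC rmorph_int.
Qed.

Lemma image_gtd_factor0 : ps_image (subst_y 0) (gtd_factor ord0)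
  (ps_mul (ps_dilate (ratr a : R)%:MP (ps_exp R r))
     (ps_div (ps_prod_dilate (ps_todd R r) (B ord0))
             (ps_prod_dilate (ps_todd R r) (B' ord0)))).
Proof.
have hv : ps_image (subst_y 0) (ps_inv (denom ord0)) (ps_todd R r).
  by apply: ps_image_inv => n; apply: image_exp_series.
apply: ps_image_mul.
  by apply: ps_image_dilate (image_exp_series _); rewrite /weight eqxx /= subst_yC.
by apply: ps_image_div; apply: image_prods.
Qed.

Lemma image_gtd_factorS (i : 'I_r) : ps_image (subst_y 'X_i)
  (gtd_factor (lift ord0 i))
  (ps_div (ps_prod_dilate (ps_todd_y 'X_i) (B (lift ord0 i)))
          (ps_prod_dilate (ps_todd_y 'X_i) (B' (lift ord0 i)))).
Proof.
have hv : ps_image (subst_y 'X_i) (ps_inv (denom (lift ord0 i))) (ps_todd_y 'X_i).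
  apply: ps_image_inv; apply: ps_image_sub; first exact: ps_image_one.
  move=> n; rewrite rmorphM /= subst_yX; congr (_ * _).
  by apply: ps_image_sub; [apply: image_exp_series|apply: ps_image_one].
have hdiv := ps_image_div (image_prods (B (lift ord0 i)) hv)
  (image_prods (B' (lift ord0 i)) hv).
move=> n; rewrite -hdiv /gtd_factor /ps_factor; congr (subst_y _ _).
rewrite /ps_mul (bigD1 ord0) //= big1 ?addr0 ?subn0 => [|j j0].
  by rewrite ps_dilate_0 exp_series_0 mul1r.
by rewrite /ps_dilate /weight /= expr0n (negPf j0 : (j == 0%N :> nat) = false) !mul0r.
Qed.

Definition gtd_coef (n : nat) (m : 'X_{1..r}) : R :=
  (slice 0 (P (gtd_factor ord0)) *
   \prod_(i < r) slice (m i) (P (gtd_factor (lift ord0 i))))`_n.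

Let image (t : A) (g : bipoly) : {poly A} := map_poly (subst_y t) g.

Lemma gtd_image n : (n < d)%N -> gtd R a B B' n =
  (image 0 (P (gtd_factor ord0)) *
   \prod_(i < r) image 'X_i (P (gtd_factor (lift ord0 i))))`_n.
Proof.
have hP t u f : ps_image (subst_y t) u f -> image t (P u) = ps_poly d f.
  move=> h; apply/polyP => k; rewrite coef_map !coef_poly.
  by case: ifP => _; [apply: h|apply: rmorph0].
move=> lt_nd; rewrite (hP _ _ _ image_gtd_factor0) coefM.
rewrite /gtd {1}/ps_mul; apply: eq_bigr => j _; have lt_jn := ltn_ord j.
rewrite coef_ps_poly; last by lia.
congr (_ * _); rewrite -(@coef_prod_ps_poly _ d); last by lia.
congr (polyseq _)`_ _; apply: eq_bigr => i _; exact/esym/hP/image_gtd_factorS.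
Qed.

Lemma image_slices t u : graded u ->
  image t (P u) = \sum_(k < d) (t ^+ k)%:P * map_poly (@mpolyC r R) (slice k (P u)).
Proof.
move=> hu; apply/polyP => n; rewrite coef_map coef_sum.
rewrite /= subst_yE; first by apply: eq_bigr => k _; rewrite coefCM coef_map coef_slice.
rewrite coef_poly; case: ifP => [lt_nd|_]; last by rewrite size_poly0.
exact: leq_trans (hu n) lt_nd.
Qed.

Definition mnm_of (f : {ffun 'I_r -> 'I_d}) : 'X_{1..r} := [multinom f i : nat | i < r].

(** Each factor is the sum over k < d of y_i^k times a series in s; distributing the product over
    these sums leaves one term per choice f of exponents. *)
Lemma gtd_sum n : (n < d)%N ->
  gtd R a B B' n = \sum_(f : {ffun 'I_r -> 'I_d})
    gtd_coef n (mnm_of f) *: 'X_[mnm_of f].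
Proof.
move=> lt_nd; rewrite gtd_image //.
under [X in _ * X]eq_bigr => i _ do
  rewrite (image_slices _ (graded_gtd_factor (lift ord0 i))).
rewrite bigA_distr_bigA mulr_sumr coef_sum; apply: eq_bigr => f _ /=.
rewrite big_split /= -!rmorph_prod.
have -> : image 0 (P (gtd_factor ord0)) =
    map_poly (@mpolyC r R) (slice 0 (P (gtd_factor ord0))).
  by apply/polyP => k; rewrite !coef_map /= subst_y0.
rewrite mulrCA -rmorphM coefCM coef_map /= mpolyXE_id mulrC mul_mpolyC.
rewrite /gtd_coef; congr (_ *: _); last by apply: eq_bigr => i _; rewrite mnmE.
by congr (polyseq (_ * _))`_n; apply: eq_bigr => i _; rewrite mnmE.
Qed.

Lemma gtd_coef_high n m : (n < mdeg m)%N -> gtd_coef n m = 0.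
Proof.
rewrite mdegE => lt_n; rewrite /gtd_coef coefM big1 // => j _.
rewrite (@coef_prod_low _ _ _ _ (fun i => m i)) ?mulr0 //.
  move=> i k lt_k; rewrite coef_slice nth_default //.
  rewrite coef_poly; case: ifP => _; last by rewrite size_poly0.
  exact: leq_trans (graded_gtd_factor _ _) lt_k.
exact: leq_ltn_trans (leq_subr _ _) lt_n.
Qed.

(** [gtd_sum] ranges over the exponents in a box of side d; those of total degree at least d have
    coefficient 0 by [gtd_coef_high], since n < d. *)
Lemma gtdE n : (n < d)%N ->
  gtd R a B B' n = \sum_(e : 'X_{1..r < d}) gtd_coef n e *: 'X_[e].
Proof.
move=> lt_nd; rewrite gtd_sum //; apply/mpolyP => m.
have mcoefE : (\sum_f gtd_coef n (mnm_of f) *: 'X_[mnm_of f] : A)@_m =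
    \sum_f gtd_coef n m * (mnm_of f == m)%:R.
  rewrite raddf_sum; apply: eq_bigr => f _ /=; rewrite mcoeffZ mcoeffX.
  by case: eqP => [->//|]; rewrite !mulr0.
rewrite mcoefE; have [lt_md|le_dm] := ltnP (mdeg m) d.
  rewrite mcoeff_mpoly //.
  have hm i : (m i < d)%N.
    by apply: leq_ltn_trans lt_md; rewrite mdegE (bigD1 i) //= leq_addr.
  pose f0 : {ffun 'I_r -> 'I_d} := [ffun i => Ordinal (hm i)].
  have f0E : mnm_of f0 = m by apply/mnmP => i; rewrite mnmE ffunE.
  rewrite (bigD1 f0) //= f0E eqxx mulr1 big1 ?addr0 // => f ne_f.
  case: eqP => [fE|]; last by rewrite mulr0.
  case/eqP: ne_f; apply/ffunP => i; apply: val_inj.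
  by rewrite /= ffunE /= -fE mnmE.
rewrite gtd_coef_high ?(leq_trans lt_nd) // big1 => [|f _]; last by rewrite mul0r.
rewrite raddf_sum big1 // => e _ /=; rewrite mcoeffZ mcoeffX.
case: eqP => [eE|]; last by rewrite mulr0.
by move: (bmdeg e); rewrite eE ltnNge le_dm.
Qed.

End Todd.

(** * Total cost *)

Section Assembly.
Local Open Scope ring_scope.
Variables (R : fieldType) (K : pred R) (C0 d r : nat).
Variables (m m' : 'I_r.+1 -> nat).
Hypothesis fastK : fast_multiplication K C0.
Hypothesis d1 : (1 < d)%N.
Hypothesis r0 : (0 < r)%N.
Hypothesis natR : forall n, (0 < n <= d)%N -> n%:R != 0 :> R.

(** As lambda >= 1, the logarithm of 2 d n is at most 2 lambda + 3 <= 5 lambda for n <= d; with the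
    factor 2 of Kronecker substitution this gives 10 C0, and the 1 keeps q positive. The logarithm
    being rounded down, k = lambda + 1 ensures d < 2^k. *)
Let lambda := trunc_log 2 d.
Let q := ((10 * C0 + 1) * lambda)%N.
Let k := lambda.+1.

Let lambda0 : (0 < lambda)%N.
Proof. by rewrite trunc_log_gt0. Qed.

Let q0 : (0 < q)%N.
Proof. by rewrite muln_gt0 lambda0 addn1. Qed.

Let d0 : (0 < d)%N. Proof. exact: ltnW. Qed.

Let dk : (d < 2 ^ k)%N.
Proof. exact: trunc_log_ltn. Qed.

Let costM n : (0 < n <= d)%N ->
  (C0 * (2 * d * n * trunc_log 2 (2 * d * n)) <= n * d * q)%N.
Proof.
move=> /andP [n0 le_nd].
have le_log : (trunc_log 2 (2 * d * n) <= 5 * lambda)%N.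
  have : (2 * d * n <= 2 ^ (1 + k + k))%N.
    by rewrite !expnD expn1 -!mulnA leq_mul // leq_mul // ltnW // (leq_ltn_trans le_nd).
  move/(leq_trunc_log 2); rewrite trunc_expnK // /k => h.
  by apply: leq_trans h _; lia.
have : (C0 * (2 * d * n * trunc_log 2 (2 * d * n)) <=
        C0 * (2 * d * n * (5 * lambda)))%N by rewrite !leq_mul.
by move/leq_trans; apply; rewrite /q; nia.
Qed.

Let costM1 n : (1 < n <= d.+1)%N -> (C0 * (n * trunc_log 2 n) <= n * q)%N.
Proof.
move=> /andP [n1 le_nd].
have le_log : (trunc_log 2 n <= 2 * lambda)%N.
  move: (leq_trans le_nd dk) => /(leq_trunc_log 2); rewrite trunc_expnK // /k => h.
  by apply: leq_trans h _; lia.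
have : (C0 * (n * trunc_log 2 n) <= C0 * (n * (2 * lambda)))%N by rewrite !leq_mul.
by move/leq_trans; apply; rewrite /q; nia.
Qed.

Section Instances.
Variable X : Type.
Local Notation F := (X -> R).
Local Notation avail := (avail K).
Local Notation compute := (compute K).
Implicit Types s t : seq F.

(** The range includes n = d because the coefficient of s^(d-1) in (e^s - 1) / s is 1 / d!. *)
Definition known_invfact s :=
  forall n, (n <= d)%N -> avail s (fun=> n`!%:R^-1).

Lemma known_invfact_ext s t : extends s t -> known_invfact s -> known_invfact t.
Proof. by move=> st h n ?; apply: avail_ext st _; apply: h. Qed.

Lemma compute_invfact s : known_nats K d s -> compute s d known_invfact.
Proof.
move=> hN; suff: forall n, (n <= d)%N -> compute s n
    (fun t => forall i, (i <= n)%N -> avail t (fun=> i`!%:R^-1)) by apply.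
elim=> [|n IH] lt_nd.
  apply: compute_ret => n; rewrite leqn0 => /eqP ->.
  by apply: avail_eq (avail1 _ _) => x; rewrite fact0 invr1.
rewrite -addn1; apply: compute_bind (IH (ltnW lt_nd)) _ => t st ht.
have nz : (n.+1%:R : R) != 0 by apply: natR.
apply: compute_le (compute_div (ht n (leqnn n)) (avail_ext st (hN _ lt_nd)) _) _ _.
- by [].
- by [].
move=> u tu hu i; rewrite addn1 leq_eqVlt => /orP [/eqP ->|lt_in].
  by apply: avail_eq hu => x; rewrite factS natrM invfM mulrC.
by apply: avail_ext tu _; apply: ht.
Qed.

Lemma known_todd_denom s : known_invfact s ->
  known K d d (fun=> ps_poly d (todd_denom R)) s.
Proof.
move=> hI i [|j] lt_id lt_jd.
  by apply: avail_eq (hI i.+1 lt_id) => x; rewrite coef_ps_poly // coefC.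
by apply: avail_eq (avail0 _ _) => x; rewrite coef_ps_poly // coefC.
Qed.

Lemma compute_todd_y_denom s : known_invfact s ->
  compute s d (known K d d (fun=> ps_poly d (todd_y_denom R))).
Proof.
move=> hI; apply: compute_le (compute_nat (n := d) (M := 1)
  (Q := fun n t => avail t (fun=> 0 - n`!%:R^-1)) _ _) _ _.
- by move=> n _; apply: avail_stable.
- move=> n t lt_nd st; apply: compute_sub (avail0 _ _) _.
  by apply: avail_ext st _; apply: hI; apply: ltnW.
- by rewrite muln1.
move=> t st h i j lt_id lt_jd.
case: i lt_id => [|i] lt_id.
  have [j0|j0] := eqVneq j 0%N.
    apply: avail_eq (avail1 _ _) => x.
    by rewrite coef_ps_poly // todd_y_denom_0 coef1 j0.
  apply: avail_eq (avail0 _ _) => x.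
  by rewrite coef_ps_poly // todd_y_denom_0 coef1 (negPf j0).
have E : (todd_y_denom R i.+1)`_j = (j == 1%N)%:R * (0 - i.+1`!%:R^-1).
  rewrite /todd_y_denom /ps_sub /ps_one /= !sub0r subr0 coefN /exp_series.
  by rewrite coefMC coefX mulrN.
have [j1|j1] := eqVneq j 1%N.
  apply: avail_eq (h i.+1 lt_id) => x.
  by rewrite coef_ps_poly // E j1 eqxx mul1r.
apply: avail_eq (avail0 _ _) => x.
by rewrite coef_ps_poly // E (negPf j1) mul0r.
Qed.

Lemma compute_prod1 (I : Type) (l : seq I) (f : X -> {poly R})
    (g : I -> X -> {poly R}) s :
  known1 K d f s -> (forall i, known1 K d (g i) s) ->
  compute s (size l * (C0 * (d * lambda)))
    (known1 K d (fun x => f x * \prod_(i <- l) g i x)).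
Proof.
elim: l f s => [|i l IH] f s hf hg.
  apply: compute_ret => n lt_nd.
  by apply: avail_eq (hf n lt_nd) => x; rewrite big_nil mulr1.
rewrite /= mulSn.
apply: compute_bind (compute_mul1 fastK d1 hf (hg i)) _ => t st h.
apply: compute_le (IH _ t h (fun j => known1_ext st (hg j))) _ _ => //.
move=> u _ hu n lt_nd; apply: avail_eq (hu n lt_nd) => x.
by rewrite big_cons mulrA.
Qed.

End Instances.

Lemma card_bmultinom : (#|{: 'X_{1..r < d}}| <= d ^ r)%N.
Proof.
have hm (e : 'X_{1..r < d}) i : (bmnm e i < d)%N.
  by apply: leq_ltn_trans (bmdeg e); rewrite mdegE (bigD1 i) //= leq_addr.
pose f (e : 'X_{1..r < d}) : {ffun 'I_r -> 'I_d} := [ffun i => Ordinal (hm e i)].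
have f_inj : injective f.
  move=> e e' /ffunP ee'; apply/val_inj/mnmP => i.
  by move: (ee' i); rewrite !ffunE => /(congr1 val).
by apply: leq_trans (leq_card f f_inj) _; rewrite card_ffun !card_ord.
Qed.

(** The index type of the cost calculus: all inputs with the prescribed sizes, on which alone the
    program may depend. *)
Definition instance := {t : rat * (('I_r.+1 -> seq int) * ('I_r.+1 -> seq int)) |
  forall i, size (t.2.1 i) = m i /\ size (t.2.2 i) = m' i}.

Implicit Type x : instance.
Definition inst_a x := (sval x).1.
Definition inst_B x := (sval x).2.1.
Definition inst_B' x := (sval x).2.2.
Definition inst_input x := gtd_input R (inst_a x) (inst_B x) (inst_B' x).

Lemma size_inst_B x i : size (inst_B x i) = m i.
Proof. by case: (svalP x i). Qed.

Lemma size_inst_B' x i : size (inst_B' x i) = m' i.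
Proof. by case: (svalP x i). Qed.

Let sizes := [seq (m i + m' i)%N | i <- enum 'I_r.+1].

Lemma shape_inst x :
  shape [seq inst_B x i ++ inst_B' x i | i <- enum 'I_r.+1] = sizes.
Proof.
rewrite /shape -map_comp; apply: eq_map => i /=.
by rewrite size_cat size_inst_B size_inst_B'.
Qed.

Definition input_state : seq (instance -> R) :=
  mkseq (fun j x => nth 0 (inst_input x) j) (sumn sizes).+1.

Lemma mem_input_state x : mem_at input_state x = inst_input x.
Proof.
rewrite /mem_at /input_state /mkseq -map_comp.
have szE : size (inst_input x) = (sumn sizes).+1.
  by rewrite /= size_map size_flatten shape_inst.
by rewrite -szE -[RHS](mkseq_nth 0).
Qed.

Lemma avail_input s j : extends input_state s ->
  avail K s (fun x => nth 0 (inst_input x) j).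
Proof.
move=> st; apply: avail_ext st _.
apply: avail_eq (avail_nth K input_state j) => x.
rewrite -mem_input_state /mem_at.
have [lt_j|le_j] := ltnP j (size input_state); first by rewrite (nth_map (fun=> 0)).
by rewrite (nth_default _ le_j); apply/esym/nth_default; rewrite (size_map _ input_state).
Qed.

Definition values_B i : seq (instance -> R) :=
  mkseq (fun j x => (nth 0 (inst_B x i) j)%:~R) (m i).
Definition values_B' i : seq (instance -> R) :=
  mkseq (fun j x => (nth 0 (inst_B' x i) j)%:~R) (m' i).

(** The successor skips register 0, which holds a. *)
Lemma input_values x (i : 'I_r.+1) j : (j < m i + m' i)%N ->
  nth 0 (inst_input x) (flatten_index sizes i j).+1 =
  (nth 0 (inst_B x i ++ inst_B' x i) j)%:~R.
Proof.
move=> lt_j; have nthE : nth 0%N sizes i = (m i + m' i)%N.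
  by rewrite (nth_map i) ?nth_ord_enum // size_enum_ord.
have lt_j' : (j < nth 0%N sizes i)%N by rewrite nthE.
rewrite /= (nth_map 0); last first.
  by rewrite size_flatten shape_inst; apply: flatten_indexP.
rewrite nth_flatten shape_inst flatten_indexKl // flatten_indexKr //.
by rewrite (nth_map i) ?nth_ord_enum // size_enum_ord.
Qed.

Lemma avail_values_B i j s : extends input_state s ->
  avail K s (nth (fun=> 0) (values_B i) j).
Proof.
move=> st; have [lt_j|le_j] := ltnP j (m i); last first.
  by rewrite nth_default ?size_mkseq //; apply: avail0.
rewrite nth_mkseq //.
apply: avail_eq (avail_input (flatten_index sizes i j).+1 st) => x.
by rewrite input_values ?nth_cat ?size_inst_B ?lt_j //; lia.
Qed.

Lemma avail_values_B' i j s : extends input_state s ->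
  avail K s (nth (fun=> 0) (values_B' i) j).
Proof.
move=> st; have [lt_j|le_j] := ltnP j (m' i); last first.
  by rewrite nth_default ?size_mkseq //; apply: avail0.
rewrite nth_mkseq //.
apply: avail_eq (avail_input (flatten_index sizes i (m i + j)).+1 st) => x.
rewrite input_values; last by lia.
by rewrite nth_cat size_inst_B ltnNge leq_addr /= addKn.
Qed.

Lemma lift_values_B i x :
  lift_values (values_B i) x = [seq c%:P | c <- [seq b%:~R | b <- inst_B x i]].
Proof.
rewrite /lift_values /values_B /mkseq -!map_comp -(size_inst_B x).
by rewrite -[in RHS](mkseq_nth 0 (inst_B x i)) -map_comp.
Qed.

Lemma lift_values_B' i x :
  lift_values (values_B' i) x = [seq c%:P | c <- [seq b%:~R | b <- inst_B' x i]].
Proof.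
rewrite /lift_values /values_B' /mkseq -!map_comp -(size_inst_B' x).
by rewrite -[in RHS](mkseq_nth 0 (inst_B' x i)) -map_comp.
Qed.

Definition weights (i : 'I_r.+1) x : R := weight R (inst_a x) i.

Definition inst_factor i x :=
  @gtd_factor R r (inst_a x) (inst_B x) (inst_B' x) i.

Lemma factorE i x :
  factor (denom R i) (weights i) (values_B i) (values_B' i) x = inst_factor i x.
Proof. by rewrite /factor lift_values_B lift_values_B'. Qed.

Lemma denom_0 (i : 'I_r.+1) : denom R i 0%N = 1.
Proof.
by rewrite /denom; case: ifP => _; rewrite ?todd_denom_0 ?todd_y_denom_0.
Qed.

Let factor_cost i :=
  ((m i + m' i) * (1 + 2 * q * k + q) + 101 * mulcost d q d)%N.

Lemma compute_inst_factor i s : extends input_state s -> known_nats K d s ->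
  known K d d (fun=> ps_poly d (denom R i)) s ->
  compute K s (factor_cost i)
    (known K d d (fun x => ps_poly d (inst_factor i x))).
Proof.
move=> st hN hv.
have hw : avail K s (weights i).
  rewrite /weights /weight; case: (i == ord0); last exact: avail0.
  exact: avail_input 0%N st.
have hB j := avail_values_B i j st; have hB' j := avail_values_B' i j st.
have := compute_factor fastK d1 q0 costM costM1 (ltnW dk) natR (denom_0 i)
  hv hw hB hB' hN.
rewrite !size_mkseq => h; apply: compute_le h (leqnn _) _ => t _ ht.
move=> n j lt_nd lt_jd; apply: avail_eq (ht n j lt_nd lt_jd) => x.
by rewrite factorE.
Qed.

Let total_cost : nat :=
  (d + (d + (d + (\sum_(i < r.+1) factor_cost i
    + #|{: 'X_{1..r < d}}| * (r * (C0 * (d * lambda)))))))%N.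

Lemma compute_gtd : compute K input_state total_cost
  (fun t => forall n (e : 'X_{1..r < d}), (n < d)%N ->
     avail K t (fun x => gtd_coef R d (inst_a x) (inst_B x) (inst_B' x) n e)).
Proof.
apply: compute_bind (compute_nats K d input_state) _ => t1 s1 hN.
apply: compute_bind (compute_invfact hN) _ => t2 s2 hI.
apply: compute_bind (compute_todd_y_denom hI) _ => t3 s3 hy.
have hN3 := known_nats_ext (extends_trans s2 s3) hN.
have h0 := known_todd_denom (known_invfact_ext s3 hI).
have s03 := extends_trans s1 (extends_trans s2 s3).
have hd (i : 'I_r.+1) : known K d d (fun=> ps_poly d (denom R i)) t3.
  by rewrite /denom; case: (i == ord0).
apply: (compute_bind (Q := fun t => forall i, known K d d
    (fun x => ps_poly d (inst_factor i x)) t)).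
  apply: compute_le (compute_all (l := enum 'I_r.+1) (N := factor_cost)
    (Q := fun i => known K d d (fun x => ps_poly d (inst_factor i x))) _ _) _ _.
  - by move=> i _ s t; apply: known_ext.
  - move=> i t _ st; apply: compute_inst_factor (extends_trans s03 st) _ _.
      exact: known_nats_ext st _.
    exact: known_ext st _.
  - by rewrite big_enum.
  by move=> t _ h i; apply: h; rewrite mem_enum.
move=> t4 s4 hF.
have hS (i : 'I_r.+1) j t : extends t4 t ->
    known1 K d (fun x => slice j (ps_poly d (inst_factor i x))) t.
  move=> st n lt_nd; have [lt_jd|le_dj] := ltnP j d.
    apply: avail_eq (avail_ext st (hF i n j lt_nd lt_jd)) => x.
    by rewrite coef_slice.
  apply: avail_eq (avail0 _ _) => x; rewrite coef_slice coef_ps_poly //.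
  rewrite nth_default // (leq_trans (graded_gtd_factor _ _ _ _ _ _)) //.
  exact: leq_trans le_dj.
apply: compute_le (compute_all (l := enum {: 'X_{1..r < d}})
  (N := fun=> (r * (C0 * (d * lambda)))%N)
  (Q := fun e => known1 K d (fun x => slice 0 (ps_poly d (inst_factor ord0 x)) *
     \prod_(i <- enum 'I_r) slice (bmnm e i) (ps_poly d (inst_factor (lift ord0 i) x))))
  _ _) _ _.
- by move=> e _ s t; apply: known1_ext.
- move=> e t _ st.
  have := compute_prod1 (enum 'I_r) (hS ord0 0%N t st)
    (fun i : 'I_r => hS (lift ord0 i) (bmnm e i) t st).
  by rewrite size_enum_ord.
- by rewrite big_enum sum_nat_const.
move=> t _ h n e lt_nd; have := h e _ n lt_nd.
rewrite mem_enum => /(_ isT); apply: avail_eq => x.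
by rewrite /gtd_coef big_enum.
Qed.

(** Integers, inverse factorials and the denominator in y cost d each, whence 3. The factors give
    101 (10 C0 + 1), with d^2 <= d^(r+1) as r > 0, and the final products C0, for at most d^r
    monomials. *)
Lemma total_cost_le :
  (total_cost <= gtd_bound (3 + 101 * (10 * C0 + 1) + C0) d m m')%N.
Proof.
rewrite /gtd_bound -/lambda.
set c := (10 * C0 + 1)%N; set D := (d ^ r.+1)%N; set S := (\sum_i _)%N.
have qE : q = (c * lambda)%N by [].
have le_dD : (d * d <= D)%N by rewrite mulnn /D leq_exp2l.
have h1 : (d <= r.+1 * D * lambda)%N.
  by apply: leq_trans (leq_trans (leq_pmulr d d0) le_dD) _; nia.
have h2 : (\sum_(i < r.+1) factor_cost i =
    S * (1 + 2 * q * k + q) + r.+1 * (101 * mulcost d q d))%N.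
  by rewrite /factor_cost big_split /= -big_distrl /= sum_nat_const card_ord.
have h3 : (1 + 2 * q * k + q <= 6 * c * lambda ^ 2)%N.
  have c0 : (0 < c)%N by rewrite /c addn1.
  have a1 : (1 <= c * lambda ^ 2)%N by rewrite muln_gt0 c0 expn_gt0 lambda0.
  have a2 : (c * lambda <= c * lambda ^ 2)%N.
    by rewrite leq_mul2l -mulnn leq_pmulr ?orbT.
  by rewrite qE /k; move: a1 a2; rewrite -mulnn; lia.
have h4 : (mulcost d q d <= D * (c * lambda))%N by rewrite /mulcost qE leq_mul.
have h5 : (#|{: 'X_{1..r < d}}| * (r * (C0 * (d * lambda))) <=
           C0 * (r.+1 * D * lambda))%N.
  have -> : (C0 * (r.+1 * D * lambda) = d ^ r * (r.+1 * (C0 * (d * lambda))))%N.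
    by rewrite /D expnS; lia.
  by rewrite leq_mul ?card_bmultinom // leq_mul.
have h6 : (r.+1 * (101 * mulcost d q d) <= 101 * c * (r.+1 * D * lambda))%N.
  have -> : (101 * c * (r.+1 * D * lambda) = r.+1 * (101 * (D * (c * lambda))))%N.
    by lia.
  by rewrite !leq_mul.
have h7 : (S * (1 + 2 * q * k + q) <= 6 * c * (lambda ^ 2 * S))%N.
  have -> : (6 * c * (lambda ^ 2 * S) = S * (6 * c * lambda ^ 2))%N by lia.
  by rewrite leq_mul.
rewrite /total_cost h2.
move: h1 h5 h6 h7; set T := (r.+1 * D * lambda)%N; set U := (lambda ^ 2 * S)%N.
have -> : ((3 + 101 * c + C0) * (T + U) =
  3 * T + C0 * T + 101 * c * T + (6 * c * U + (3 + 95 * c + C0) * U))%N by lia.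
by move: ((3 + 95 * c + C0) * U)%N (101 * c * T)%N (6 * c * U)%N (C0 * T)%N => *; lia.
Qed.

Lemma gtd_computable_large :
  gtd_computable K d m m' (gtd_bound (3 + 101 * (10 * C0 + 1) + C0) d m m').
Proof.
have [P [t [costP _ eP ht]]] := compute_gtd.
(* The pairs (n, e) being finitely many, their operands can be chosen as a function. *)
have /fin_all_exists [o ho] : forall ne : 'I_d * 'X_{1..r < d}, exists o,
    forall x, read K (mem_at t x) o =
      Some (gtd_coef R d (inst_a x) (inst_B x) (inst_B' x) ne.1 ne.2).
  by move=> [n e]; apply: ht; apply: ltn_ord.
exists P, (fun n e => o (n, e)); split.
  exact: leq_trans costP total_cost_le.
move=> a B B' _ sizeB _.
exists (fun n e => gtd_coef R d a B B' n e); split=> [n e|n]; last exact: gtdE.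
pose x : instance := exist _ (a, (B, B')) sizeB.
have := eP x; rewrite mem_input_state /output => ->.
exact: (ho (n, e) x).
Qed.

End Assembly.

(** * The case d = 1 and the choice of the field *)

Section Field.
Local Open Scope ring_scope.

(** For d = 1 the logarithms, and with them the bound, are 0, so that no instruction is allowed; but
    gtd_0 = 1 is a constant available for free. *)
Lemma gtd_computable_one (R : fieldType) (K : pred R) r m m' N :
  @gtd_computable R K 1 r m m' N.
Proof.
exists [::], (fun _ e => Cst (bmnm e == 0%MM)%:R); split=> // a B B' _ _ _.
exists (fun _ e => (bmnm e == 0%MM)%:R); split=> [n e|n].
  by rewrite /output /=; case: (bmnm e == 0%MM); rewrite ?eqxx ?orbT.
rewrite (gtdE R a B B' (ltn_ord n)); apply: eq_bigr => e _; congr (_ *: _).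
have n0 : n = 0%N :> nat by case: n => [[|//]].
have e0 : bmnm e = 0%MM.
  apply/eqP; rewrite -mdeg_eq0 -leqn0 -ltnS; exact: bmdeg.
rewrite n0 e0 eqxx /gtd_coef coefM big_ord1 subnn coef0_prod coef_slice.
have h0 (i : 'I_r.+1) : (ps_poly 1 (gtd_factor R a B B' i))`_0`_0 = 1.
  by rewrite coef_ps_poly // /gtd_factor ps_factor_0 ?exp_series_0 // coef1.
by rewrite h0 mul1r big1 // => i _; rewrite coef_slice mnmE h0.
Qed.

Lemma gtd_computable_field (R : fieldType) (K : pred R) C0 d r m m' :
  fast_multiplication K C0 -> (0 < d)%N -> (0 < r)%N ->
  (forall n, (0 < n <= d)%N -> n%:R != 0 :> R) ->
  @gtd_computable R K d r m m' (gtd_bound (3 + 101 * (10 * C0 + 1) + C0) d m m').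
Proof.
move=> fastK; rewrite leq_eqVlt => /orP [/eqP <- _ _|d1 r0 natR].
  exact: gtd_computable_one.
exact: gtd_computable_large.
Qed.

End Field.

Theorem theorem22 (C0 : nat) :
  exists C : nat,
    (forall (K : pred rat), fast_multiplication K C0 ->
     forall (d r : nat) (m m' : 'I_r.+1 -> nat), 0 < d -> 0 < r ->
       gtd_computable K d m m' (gtd_bound C d m m')) /\
    (forall (p : nat) (K : pred 'F_p), prime p -> fast_multiplication K C0 ->
     forall (d r : nat) (m m' : 'I_r.+1 -> nat), 0 < d -> d < p -> 0 < r ->
       gtd_computable K d m m' (gtd_bound C d m m')).
Proof.
exists (3 + 101 * (10 * C0 + 1) + C0); split=> [K|p K p_pr] fastK d r m m' d0.
  move=> r0; apply: gtd_computable_field => // n /andP [n0 _].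
  by rewrite Num.Theory.pnatr_eq0 -lt0n.
move=> lt_dp r0; apply: gtd_computable_field => // n /andP [n0 le_nd].
by rewrite -(dvdn_pcharf (pchar_Fp p_pr)) gtnNdvd // (leq_ltn_trans le_nd).
Qed.
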